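(* Let $n,m$ be positive integers and let $\mathbf{r}=(r_1,\dots,r_m)$, $\mathbf{s}=(s_1,\dots,s_m)$ be sequences of nonnegative integers with $r=r_1+\dots+r_m$ and $s=s_1+\dots+s_m$. Then \begin{multline*} |\mathrm{YB}(n,\mathbf{r},\mathbf{s})| = \left((r+s+1)n+m\binom n2+\sum_{i=1}^m r_is_i\right)! \prod_{i=1}^m \frac{F(r_i)F(s_i)}{F(n+r_i+s_i)}\\ \times \frac{2^n}{n!} \prod_{j=1}^n \frac{(jm)!!\, (2r+(j-1)m)!!\,(2s+(j-1)m)!!}{m!!\,(2r+2s+2+(n+j-2)m)!!}. \end{multline*}
   Context: $F(k)=1!\,2!\cdots(k-1)!$ (empty product $=1$, so $F(0)=F(1)=1$). For a nonnegative integer $k$, $k!!=\prod_{j=0}^{\lfloor (k-1)/2\rfloor}(k-2j)$, so $0!!=1$. For nonnegative integers $p,q$, the $(n,p,q)$-staircase is the set of cells $(i,j)$ (row $i$, column $j$) with $1\le i\le p+n$, $1\le j\le n+q$ and $i\le j+p$ (an $(p+n)\times(n+q)$ rectangle with the cells below the cells $(j+p,j)$, $1\le j\le n$, removed); the cell $(j+p,j)$ is its $j$th diagonal cell. Thus a row $i>p$ contains the diagonal cell $(i,i-p)$, a column $j\le n$ contains the diagonal cell $(j+p,j)$, and other rows/columns contain no diagonal cell. Let page $\lambda^{(i)}$ be the $(n,r_i,s_i)$-staircase, $1\le i\le m$, and identify, for each $1\le j\le n$, the $j$th diagonal cells of all pages into one cell. An $(n,\mathbf{r},\mathbf{s})$-Selberg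 book is a filling of the resulting cells with $1,2,\dots,N$, $N=(r+s+1)n+m\binom n2+\sum_i r_is_i$, each used once, such that in each page every non-diagonal cell has entry larger than the entry of the diagonal cell in its row (if its row contains one) and smaller than the entry of the diagonal cell in its column (if its column contains one). An $(n,\mathbf{r},\mathbf{s})$-Young book is such a Selberg book in which, in each page, entries increase from left to right along rows and from top to bottom along columns. $\mathrm{YB}(n,\mathbf{r},\mathbf{s})$ denotes the set of $(n,\mathbf{r},\mathbf{s})$-Young books. *)

(* Defs.v *)
From mathcomp Require Import all_boot all_order all_algebra.
Set Implicit Arguments. Unset Strict Implicit. Unset Printing Implicit Defensive.
Import GRing.Theory Num.Theory.

Definition superfact (k : nat) : nat := \prod_(i < k) i`!.

Fixpoint dfact (k : nat) : nat :=
  match k with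
  | 0 => 1
  | 1 => 1
  | k'.+2 => k'.+2 * dfact k'
  end.

Section Book.
Variables (n m : nat) (r s : 'I_m -> nat).

Definition YBsize : nat :=
  ((\sum_(i < m) r i) + (\sum_(i < m) s i) + 1) * n + m * 'C(n, 2)
  + \sum_(i < m) r i * s i.

(* Coordinates are 0-based: row a in [0, r_i + n), column b in [0, n + s_i).
   The 1-based cell (a+1, b+1) lies in the (n, r_i, s_i)-staircase iff
   a <= b + r_i; it is the (b+1)-th diagonal cell iff a = b + r_i and b < n. *)
Definition incell (i : 'I_m) (a b : nat) : bool :=
  [&& a < r i + n, b < n + s i & a <= b + r i].

Definition isdiag (i : 'I_m) (a b : nat) : bool := (a == b + r i) && (b < n).

(* a strict bound on all coordinates *)
Definition Bnd : nat := (n + \sum_(i < m) r i + \sum_(i < m) s i).+1.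

Definition offcell (x : 'I_m * 'I_Bnd * 'I_Bnd) : bool :=
  incell x.1.1 x.1.2 x.2 && ~~ isdiag x.1.1 x.1.2 x.2.

(* The cells of the book after identifying the j-th diagonal cells of all
   pages into one cell (inl j, j = 0..n-1); the non-diagonal cells of page i
   are inr (i, a, b). *)
Definition YBcell : finType := ('I_n + {x : 'I_m * 'I_Bnd * 'I_Bnd | offcell x})%type.

Definition cellof (i : 'I_m) (a b : nat) : option YBcell :=
  if isdiag i a b then omap inl (insub b : option 'I_n)
  else if incell i a b then
    omap inr (insub (i, inord a, inord b) : option {x : 'I_m * 'I_Bnd * 'I_Bnd | offcell x})
  else None.

(* a filling: entries 0..N-1 stand for 1..N *)
Definition filling := {ffun YBcell -> 'I_YBsize}.

Definition optlt (f : filling) (c : YBcell) (d : option YBcell) (dir : bool) : bool :=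
  match d with
  | Some d' => if dir then f c < f d' else f d' < f c
  | None => true
  end.

Definition page_ok (f : filling) (i : 'I_m) (a b : nat) : bool :=
  match cellof i a b with
  | Some c =>
      [&& optlt f c (cellof i a b.+1) true,
          optlt f c (cellof i a.+1 b) true &
      (* Selberg: non-diagonal cells exceed the diagonal cell of their row
         and are smaller than the diagonal cell of their column *)
      if c is inr _ then
        (if r i <= a then optlt f c (cellof i a (a - r i)) false else true)
        && (if b < n then optlt f c (cellof i (b + r i) b) true else true)
      else true]
  | None => true
  end.

Definition is_young_book (f : filling) : bool :=
  [&& injectiveb f, [forall k : 'I_YBsize, k \in codom f] &
      [forall i : 'I_m, forall a : 'I_Bnd, forall b : 'I_Bnd, page_ok f i a b]].

Definition YB : {set filling} := [set f | is_young_book f].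

End Book.

(* Main.v *)
Require Import Defs.
From mathcomp Require Import all_boot all_order all_algebra.
From mathcomp Require Import perm ring lra zify.
Import Order.TTheory GRing.Theory Num.Theory.
Local Open Scope ring_scope.

(** Count the semistandard fillings (rows weakly, columns strictly increasing)
    of the book with values in [0, q).  Up to O(q^(N-1)) they number
    |YB| q^N / N!, since non-injective fillings are negligible and an injective
    one is a Young book together with an N-subset of [0, q).

    On the other hand, once the diagonal x_1 < ... < x_n is fixed the pages are
    independent, and a page, completed by forced triangles of entries, is a
    Gelfand-Tsetlin pattern with top row (0, ..., r_i - 1, x, q, ..., q + s_i - 1);
    there are prod_{a<b} (t_b - t_a) / F(k) patterns with top row t_1 < ... < t_k.
    The leading term of the resulting sum over x is a Riemann sum of the Selberg
    integral with exponent m on the Vandermonde product.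

    That Riemann sum T_{n,r,s}(q) is evaluated asymptotically without integrals.
    A discrete version of Aomoto's argument (summing the differences of
    x_i u_i prod_{j in M} u_j w(x), where u_j = q - x_j and w is the summand) gives
    the ratio T_{n,r,s+1} / T_{n,r,s}, and summing over the largest point gives
    T_{n+1,r,0}(q) = sum_{y<q} y^r T_{n,r,m}(y). *)

Set Implicit Arguments.
Unset Strict Implicit.
Unset Printing Implicit Defensive.

(** * Growth of functions on the naturals *)

(** The differences in Aomoto's argument sum to zero because x_i u_i vanishes at both ends x_i = 0
    and x_i = q. Restricting to increasing x keeps the Vandermonde power polynomial even for odd m,
    but adds a boundary inside the box, where the shift of x_i breaks the order. Points near that
    boundary are rarer by a factor q, and there a Vandermonde factor is at most 1 in absolute value,
    so they weigh no more than the second-order remainder of the shift.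

    Summing over all k-subsets M replaces the product over M by the elementary symmetric sum e_k(u).
    The resulting recursion in k leads from e_0 = 1 to e_n, the product of all u_j, that is from s
    to s + 1. The recursion on n enters at s = m because the largest point y contributes the factors
    (y - x_j)^m; hence the induction on n keeps s arbitrary.

    The forced triangles are needed because the product formula counts full triangular patterns,
    while a page is a staircase. *)

Definition bigO (d : nat) (f : nat -> rat) :=
  exists K : rat, forall q, `|f q| <= K * q.+1%:R ^+ d.

(** At [q = 0] the bound reads |f 0| <= K. The base [q.+1] is what allows the bound to be imposed at
    every [q] rather than eventually. *)
Lemma bigO_pos d f : bigO d f -> exists2 K : rat, 0 <= K & forall q, `|f q| <= K * q.+1%:R ^+ d.
Proof.
case=> K hK; exists K => //.
by have := hK 0%N; rewrite expr1n mulr1; apply: le_trans; rewrite normr_ge0.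
Qed.

Lemma eq_bigO d f g : f =1 g -> bigO d f -> bigO d g.
Proof. by move=> e [K h]; exists K => q; rewrite -e. Qed.

Lemma bigO_le d f g : (forall q, `|f q| <= `|g q|) -> bigO d g -> bigO d f.
Proof. by move=> e [K h]; exists K => q; apply: le_trans (e q) (h q). Qed.

Lemma bigO_weak d d' f : (d <= d')%N -> bigO d f -> bigO d' f.
Proof.
move=> ld /bigO_pos [K K0 h]; exists K => q; apply: le_trans (h q) _.
by rewrite ler_wpM2l // ler_weXn2l // ler1n.
Qed.

Lemma bigO0 d : bigO d (fun=> 0).
Proof. by exists 0 => q; rewrite normr0 mul0r. Qed.

Lemma bigOD d f g : bigO d f -> bigO d g -> bigO d (fun q => f q + g q).
Proof.
move=> [K h] [K' h']; exists (K + K') => q.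
by rewrite mulrDl (le_trans (ler_normD _ _)) // lerD.
Qed.

Lemma bigOM d d' f g : bigO d f -> bigO d' g -> bigO (d + d') (fun q => f q * g q).
Proof.
move=> [K h] [K' h']; exists (K * K') => q.
by rewrite normrM exprD mulrACA ler_pM.
Qed.

Lemma bigO_cst c : bigO 0 (fun=> c).
Proof. by exists `|c| => q; rewrite mulr1. Qed.

Lemma bigOZ d c f : bigO d f -> bigO d (fun q => c * f q).
Proof. by move=> h; apply: (bigOM (bigO_cst c) h). Qed.

Lemma bigON d f : bigO d f -> bigO d (fun q => - f q).
Proof. by move=> h; apply: bigO_le h => q; rewrite normrN. Qed.

Lemma bigOB d f g : bigO d f -> bigO d g -> bigO d (fun q => f q - g q).
Proof. by move=> h1 h2; apply: bigOD => //; apply: bigON. Qed.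

Lemma bigO_X d : bigO d (fun q => q%:R ^+ d).
Proof.
exists 1 => q; rewrite mul1r ger0_norm ?exprn_ge0 ?ler0n //.
by apply: lerXn2r; rewrite ?nnegrE ?ler0n // ler_nat.
Qed.

Lemma bigO_sum d (I : Type) (s : seq I) (P : pred I) (f : I -> nat -> rat) :
  (forall i, P i -> bigO d (f i)) -> bigO d (fun q => \sum_(i <- s | P i) f i q).
Proof.
move=> h; elim: s => [|i s IH].
  by apply: (eq_bigO _ (bigO0 d)) => q; rewrite big_nil.
case Pi: (P i).
  by apply: (eq_bigO _ (bigOD (h i Pi) IH)) => q; rewrite big_cons Pi.
by apply: (eq_bigO _ IH) => q; rewrite big_cons Pi.
Qed.

Lemma bigO_psum d f : bigO d f -> bigO d.+1 (fun q => \sum_(y < q) f y).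
Proof.
move=> /bigO_pos [K K0 h]; exists K => q.
apply: (le_trans (ler_norm_sum _ _ _)).
apply: (@le_trans _ _ (\sum_(y < q) K * q.+1%:R ^+ d)).
  apply: ler_sum => y _; apply: le_trans (h y) _; rewrite ler_wpM2l //.
  by apply: lerXn2r; rewrite ?nnegrE ?ler0n // ler_nat ltnS ltnW.
rewrite sumr_const card_ord -[_ *+ q]mulr_natr -mulrA ler_wpM2l // exprSr ler_wpM2l ?exprn_ge0 ?ler0n //.
by rewrite ler_nat.
Qed.

(** Discrete mean value theorem for the power d + 1; telescoped over y, it compares a power sum with
    the integral. *)
Lemma pow_diff_bounds (d y : nat) :
  (d.+1%:R * y%:R ^+ d <= y.+1%:R ^+ d.+1 - y%:R ^+ d.+1 :> rat) &&
  (y.+1%:R ^+ d.+1 - y%:R ^+ d.+1 <= d.+1%:R * y.+1%:R ^+ d :> rat).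
Proof.
have y0 : 0 <= y%:R :> rat by rewrite ler0n.
have yS : y.+1%:R = y%:R + 1 :> rat by rewrite -natr1.
elim: d => [|d /andP[IH1 IH2]].
  by rewrite !expr0 !expr1 yS; lra.
set a : rat := y.+1%:R; set b : rat := y%:R; rewrite -/a -/b in IH1 IH2 yS y0.
have ab : b <= a by rewrite yS; lra.
have pab : b ^+ d.+1 <= a ^+ d.+1 by apply: lerXn2r; rewrite ?nnegrE ?ler0n.
have -> : a ^+ d.+2 - b ^+ d.+2 = a ^+ d.+1 + b * (a ^+ d.+1 - b ^+ d.+1).
  by rewrite !(exprS _ d.+1) yS; ring.
have e : d.+2%:R = d.+1%:R + 1 :> rat by rewrite -natr1.
apply/andP; split.
  rewrite e mulrDl mul1r addrC lerD //.
  have -> : d.+1%:R * b ^+ d.+1 = b * (d.+1%:R * b ^+ d) by rewrite exprS mulrCA.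
  by rewrite ler_wpM2l.
rewrite e mulrDl mul1r addrC lerD //.
apply: (le_trans (ler_wpM2l y0 IH2)); rewrite mulrCA [a ^+ d.+1]exprS ler_wpM2l ?ler0n //.
by apply: ler_wpM2r => //; rewrite exprn_ge0 ?ler0n.
Qed.

Lemma asym_powersum d :
  bigO d (fun q => \sum_(y < q) y%:R ^+ d - d.+1%:R^-1 * q%:R ^+ d.+1).
Proof.
have dp : 0 < d.+1%:R :> rat by rewrite ltr0n.
(* The power sum lies below q^(d+1)/(d+1) and misses it by at most q^d, the size of the last
   increment. *)
suff H q : (\sum_(y < q) y%:R ^+ d <= d.+1%:R^-1 * q%:R ^+ d.+1 :> rat) &&
    (d.+1%:R^-1 * q%:R ^+ d.+1 <= \sum_(y < q) y%:R ^+ d + q%:R ^+ d :> rat).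
  apply: bigO_le (bigO_X d) => q; rewrite (ger0_norm (x := q%:R ^+ d)) ?exprn_ge0 ?ler0n //.
  have /andP[] := H q; set u := \sum_(y < q) _; set v := _ * _; set w := q%:R ^+ d => h1 h2.
  by rewrite ler_norml; apply/andP; split; lra.
elim: q => [|q /andP[IH1 IH2]].
  by rewrite big_ord0 expr0n /= mulr0 lexx add0r exprn_ge0.
have /andP[h1 h2] := pow_diff_bounds d q.
rewrite big_ord_recr /=.
have -> : d.+1%:R^-1 * q.+1%:R ^+ d.+1 = d.+1%:R^-1 * q%:R ^+ d.+1 +
    d.+1%:R^-1 * (q.+1%:R ^+ d.+1 - q%:R ^+ d.+1) :> rat by ring.
have h3 : q%:R ^+ d <= d.+1%:R^-1 * (q.+1%:R ^+ d.+1 - q%:R ^+ d.+1) :> rat.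
  by rewrite -ler_pdivrMl ?invr_gt0 // invrK.
have h4 : d.+1%:R^-1 * (q.+1%:R ^+ d.+1 - q%:R ^+ d.+1) <= q.+1%:R ^+ d :> rat.
  by rewrite ler_pdivrMl.
move: IH1 IH2 h3 h4; set u := \sum_(y < q) _; set v := _ * q%:R ^+ d.+1; set w := _ * (_ - _).
set a := q%:R ^+ d; set b := q.+1%:R ^+ d => IH1 IH2 h3 h4.
by apply/andP; split; lra.
Qed.

Lemma bigO_const_eq0 d c : bigO d (fun q => c * q%:R ^+ d.+1) -> c = 0.
Proof.
move=> /bigO_pos [K K0 h]; apply/eqP; rewrite -normr_eq0 eq_le normr_ge0 andbT.
rewrite leNgt; apply/negP => c0.
(* This [q] is at least 1 and exceeds K 2^d / |c|. As q + 1 <= 2 q, the assumed bound would give |c|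
   q <= K 2^d. *)
set q := (Num.truncn (K * 2 ^+ d / `|c|)).+1.
have hq := h q.
have q0 : 0 < q%:R :> rat by rewrite ltr0n.
have e : K * 2 ^+ d / `|c| < q%:R :> rat by rewrite /q; apply: truncnS_gt.
rewrite ltr_pdivrMr // in e.
have : `|c * q%:R ^+ d.+1| <= K * 2 ^+ d * q%:R ^+ d.
  apply: le_trans hq _; rewrite -mulrA -exprMn ler_wpM2l //.
  apply: lerXn2r; rewrite ?nnegrE ?ler0n ?mulr_ge0 ?ler0n //.
  by rewrite -natrM ler_nat /q; lia.
rewrite normrM [`|q%:R ^+ _|]ger0_norm ?exprn_ge0 ?ler0n // exprS mulrA ler_pM2r ?exprn_gt0 //.
by move=> h2; have := lt_le_trans e; rewrite mulrC => /(_ _ h2); rewrite ltxx.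
Qed.

(** * Sums over boxes *)

Lemma big_seq_bij (T1 T2 : eqType) (s1 : seq T1) (s2 : seq T2) (phi : T1 -> T2)
    (psi : T2 -> T1) (F : T2 -> rat) :
  uniq s1 -> uniq s2 ->
  (forall x, x \in s1 -> phi x \in s2 /\ psi (phi x) = x) ->
  (forall y, y \in s2 -> psi y \in s1 /\ phi (psi y) = y) ->
  \sum_(y <- s2) F y = \sum_(x <- s1) F (phi x).
Proof.
move=> u1 u2 h1 h2; rewrite -(big_map phi xpredT F); apply: perm_big.
apply: uniq_perm => //.
  rewrite map_inj_in_uniq // => x y /h1[_ ex] /h1[_ ey] e.
  by rewrite -ex -ey e.
move=> y; apply/idP/mapP => [/h2[h e]|[x /h1[h _] ->]//].
by exists (psi y).
Qed.

Section Box.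
Variable T : finType.

Definition nval q (x : {ffun T -> 'I_q}) : {ffun T -> nat} := [ffun j => val (x j)].
(** Points are functions into [nat], not into ['I_q], so that a coordinate may be shifted to the
    value [q] itself. *)
Definition box q : seq {ffun T -> nat} := [seq nval x | x : {ffun T -> 'I_q}].

Lemma nval_inj q : injective (@nval q).
Proof. by move=> x y /ffunP e; apply/ffunP => j; apply/val_inj; have := e j; rewrite !ffunE. Qed.

Lemma uniq_box q : uniq (box q).
Proof. by rewrite map_inj_uniq ?enum_uniq //; exact: (@nval_inj q). Qed.

Lemma mem_box q (x : {ffun T -> nat}) : (x \in box q) = [forall j, (x j < q)%N].
Proof.
apply/mapP/forallP => [[y _ ->] j|h]; first by rewrite ffunE; apply: ltn_ord.
exists [ffun j => Ordinal (h j)]; first by rewrite mem_enum.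
by apply/ffunP => j; rewrite !ffunE.
Qed.

Lemma size_box q : size (box q) = (q ^ #|T|)%N.
Proof. by rewrite size_map -cardE card_ffun card_ord. Qed.

Lemma big_box q (P : pred {ffun T -> nat}) (F : {ffun T -> nat} -> rat) :
  \sum_(x <- box q | P x) F x = \sum_(x : {ffun T -> 'I_q} | P (nval x)) F (nval x).
Proof. by rewrite big_map /= enumT. Qed.

Definition upd (x : {ffun T -> nat}) i v : {ffun T -> nat} :=
  [ffun j => if j == i then v else x j].

(** Exchanging x_i with an independent v < q is an involution. It reduces a sum over the box to
    one-dimensional sums along coordinate i. *)
Lemma box_average q i (F : {ffun T -> nat} -> rat) :
  q%:R * \sum_(x <- box q) F x = \sum_(x <- box q) \sum_(v < q) F (upd x i v).
Proof.
rewrite !big_box.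
pose up (p : {ffun T -> 'I_q} * 'I_q) : {ffun T -> 'I_q} * 'I_q :=
  ([ffun j => if j == i then p.2 else p.1 j], p.1 i).
have upK : involutive up.
  move=> [x v]; congr (_, _); rewrite /= ?ffunE ?eqxx //.
  by apply/ffunP => j; rewrite !ffunE; case: eqP => // ->.
rewrite pair_big /= (reindex up) /=; last by apply: onW_bij; exists up.
transitivity (\sum_(p : {ffun T -> 'I_q} * 'I_q) F (nval p.1)).
  rewrite -(pair_big xpredT xpredT (fun x (v : 'I_q) => F (nval x))) /=.
  rewrite mulr_sumr; apply: eq_bigr => x _.
  by rewrite sumr_const card_ord mulr_natl.
apply: eq_bigr => -[x v] _ /=; congr (F _); apply/ffunP => j.
by rewrite !ffunE; case: eqP => [->|].
Qed.

Lemma upd_upd x i v w : upd (upd x i v) i w = upd x i w.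
Proof. by apply/ffunP => j; rewrite !ffunE; case: eqP. Qed.

Lemma upd_same x i v : upd x i v i = v.
Proof. by rewrite ffunE eqxx. Qed.

Lemma upd_neq x i v j : j != i -> upd x i v j = x j.
Proof. by rewrite ffunE => /negbTE ->. Qed.

Lemma box_telescope q i (H : {ffun T -> nat} -> rat) :
  (forall x, H (upd x i 0%N) = 0) -> (forall x, H (upd x i q) = 0) ->
  \sum_(x <- box q) (H (upd x i (x i).+1) - H x) = 0.
Proof.
move=> h0 hq; case: q hq => [|q] hq.
  rewrite big_box big1 // => x; by case: (x i).
have : q.+1%:R * \sum_(x <- box q.+1) (H (upd x i (x i).+1) - H x) = 0.
  rewrite (box_average q.+1 i (fun x => H (upd x i (x i).+1) - H x)) big1 // => x _.
  under eq_bigr => v _ do rewrite upd_same upd_upd.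
  rewrite -(big_mkord xpredT (fun v => H (upd x i v.+1) - H (upd x i v))).
  by rewrite telescope_sumr // h0 hq subr0.
by move/eqP; rewrite mulf_eq0 pnatr_eq0 /= => /eqP.
Qed.

(* Away from near collisions, x_i may be replaced by x_i + 1 without changing the relative order;
   they form a set of codimension one, hence contribute lower order terms. *)
Definition near_collision i (x : {ffun T -> nat}) : bool :=
  [exists j, (j != i) && ((x i == x j) || ((x i).+1 == x j))].

(** On each line in direction i, every j excludes at most two values of x_i, namely x_j and x_j -
    1. *)
Lemma count_near_collision q i :
  (0 < q)%N ->
  \sum_(x <- box q) (near_collision i x)%:R <= 2 * #|T|%:R * q%:R ^+ #|T|.-1 :> rat.
Proof.
move=> q0; have q0' : 0 < q%:R :> rat by rewrite ltr0n.
have T0 : (0 < #|T|)%N by apply/card_gt0P; exists i.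
rewrite -(ler_pM2l q0') (box_average q i (fun x => (near_collision i x)%:R)).
have -> : q%:R * (2 * #|T|%:R * q%:R ^+ #|T|.-1) = \sum_(x <- box q) 2 * #|T|%:R :> rat.
  rewrite big_const_seq count_predT size_box iter_addr_0 -[_ *+ (_ ^ _)]mulr_natr natrX.
  by rewrite mulrCA -exprS prednK.
apply: ler_sum => x _.
apply: (@le_trans _ _ (\sum_(v < q) \sum_(j : T) ((x j == v)%:R + (x j == v.+1)%:R))).
  apply: ler_sum => v _; rewrite /near_collision.
  case: existsP => [[j /andP[ji h]]|_]; last first.
    by apply: sumr_ge0 => j _; rewrite addr_ge0.
  rewrite (bigD1 j) //= upd_same (upd_neq _ _ ji) in h *.
  rewrite -[1%:R]addr0 lerD //; last by apply: sumr_ge0 => l _; rewrite addr_ge0.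
  by case/orP: h => /eqP <-; rewrite eqxx ?lerDl ?lerDr.
rewrite exchange_big /=.
have -> : 2 * #|T|%:R = \sum_(j : T) 2 :> rat by rewrite sumr_const mulr_natr.
apply: ler_sum => j _; rewrite big_split /=.
have one (f : nat -> nat) : injective f -> \sum_(v < q) ((x j == f v)%:R : rat) <= 1.
  move=> fi; case: (boolP [exists v : 'I_q, x j == f v]) => [/existsP[v /eqP e]|].
    rewrite (bigD1 v) //= e eqxx big1 ?addr0 // => w wv.
    by case: eqP => // /fi e2; case/eqP: wv; apply/val_inj.
  rewrite negb_exists => /forallP h; rewrite big1 // => v _.
  by rewrite (negbTE (h v)).
have h1 := one _ (@inj_id nat); have h2 := one _ succn_inj.
exact: lerD h1 h2.
Qed.
End Box.

(** * Discrete derivative of a product of linear factors *)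

Section ProductDerivative.
Implicit Types (s t : seq (rat * rat)).

(** A pair (a, b) stands for the linear factor a + b t. Then [pval] and [pshift] are the values of
    the product at t = 0 and t = 1, and [pder] is its derivative at t = 0. *)
Definition pval s : rat := \prod_(p <- s) p.1.
Definition pshift s : rat := \prod_(p <- s) (p.1 + p.2).
Fixpoint pder s : rat :=
  if s is p :: s' then p.2 * pval s' + p.1 * pder s' else 0.

Lemma pval_cons p s : pval (p :: s) = p.1 * pval s.
Proof. exact: big_cons. Qed.

Lemma pval_cat s t : pval (s ++ t) = pval s * pval t.
Proof. exact: big_cat. Qed.

Lemma pder_cat s t : pder (s ++ t) = pder s * pval t + pval s * pder t.
Proof.
elim: s => [|p s IH] /=; first by rewrite /pval big_nil; ring.
by rewrite pval_cat pval_cons IH; ring.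
Qed.

(** Logarithmic derivative without division: [c p] replaces a0 b / a, so factors with a = 0 are
    allowed. *)
Lemma pder_prop a0 (c : rat * rat -> rat) s :
  (forall p, p \in s -> a0 * p.2 = c p * p.1) -> a0 * pder s = (\sum_(p <- s) c p) * pval s.
Proof.
elim: s => [|p s IH] h /=; first by rewrite big_nil; ring.
rewrite big_cons pval_cons mulrDr mulrA h ?mem_head // mulrCA IH; first by ring.
by move=> x xs; apply: h; rewrite inE xs orbT.
Qed.

Variable B : rat.
Hypothesis B1 : 1 <= B.

Lemma prod_le_pow (s : seq rat) :
  (forall a, a \in s -> `|a| <= B) -> `|\prod_(a <- s) a| <= B ^+ size s.
Proof.
elim: s => [|a s IH] h; first by rewrite big_nil normr1.
rewrite big_cons normrM exprS ler_pM ?normr_ge0 ?h ?mem_head ?IH // => x xs.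
by apply: h; rewrite inE xs orbT.
Qed.

Lemma prod_le_pow_pred (s : seq rat) a0 : a0 \in s -> `|a0| <= 1 ->
  (forall a, a \in s -> `|a| <= B) -> `|\prod_(a <- s) a| <= B ^+ (size s).-1.
Proof.
move=> a0s a01 h; rewrite (perm_big _ (perm_to_rem a0s)) big_cons normrM -(size_rem a0s).
rewrite -[X in _ <= X]mul1r ler_pM ?normr_ge0 // prod_le_pow // => a /mem_rem; exact: h.
Qed.

Definition pbounded s := forall p, p \in s -> `|p.1| <= B /\ `|p.2| <= 1.

Lemma pbounded_cons p s : pbounded (p :: s) -> [/\ `|p.1| <= B, `|p.2| <= 1 & pbounded s].
Proof.
move=> h; have [] := h p (mem_head _ _); split => // x xs.
by apply: h; rewrite inE xs orbT.
Qed.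

Lemma pval_bound s : pbounded s -> `|pval s| <= B ^+ size s.
Proof.
move=> h; rewrite /pval -(big_map fst xpredT id) -(size_map fst) prod_le_pow // => a /mapP[p ps ->].
by case: (h p ps).
Qed.

(** A derivative loses one factor. The power of [B] stands on the left, here and in the next bound,
    so that no exponent is a truncated difference. *)
Lemma pder_bound s : pbounded s -> B * `|pder s| <= (size s)%:R * B ^+ size s.
Proof.
have B0 : 0 <= B := le_trans ler01 B1.
elim: s => [|p s IH] /=; first by rewrite normr0 mulr0 mul0r.
case/pbounded_cons => h1 h2 hs; have ph := pval_bound hs; have dh := IH hs.
apply: (@le_trans _ _ (B * (`|p.2| * `|pval s| + `|p.1| * `|pder s|))).
  by rewrite ler_wpM2l // -!normrM ler_normD.
rewrite -natr1 mulrDl mul1r mulrDr addrC lerD //.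
  rewrite mulrCA exprS [X in _ <= X]mulrCA ler_pM ?mulr_ge0 //.
by rewrite exprS ler_wpM2l // -[X in _ <= X]mul1r ler_pM.
Qed.

(** Second-order Taylor remainder: each of its terms lacks at least two of the original factors. The
    base 4 absorbs the doubling from |a + b| <= 2 B together with the bound n <= 4^n on the
    derivative term. *)
Lemma pshift_expand s : pbounded s ->
  B ^+ 2 * `|pshift s - pval s - pder s| <= (4 ^+ size s) * B ^+ size s.
Proof.
have B0 : 0 <= B := le_trans ler01 B1.
elim: s => [|p s IH] /=.
  by rewrite /pshift /pval !big_nil !subrr normr0 mulr0 !expr0 mulr1.
case/pbounded_cons => h1 h2 hs; have ph := pval_bound hs; have dh := pder_bound hs.
have {IH} rh := IH hs; rewrite pval_cons /pshift big_cons -/(pshift s).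
set R := pshift s - pval s - pder s in rh.
have -> : (p.1 + p.2) * pshift s - p.1 * pval s - (p.2 * pval s + p.1 * pder s)
   = (p.1 + p.2) * R + p.2 * pder s by rewrite /R; ring.
set n := size s in ph dh rh *.
have bn : 0 <= B ^+ n by rewrite exprn_ge0.
have h12 : `|p.1 + p.2| <= 2 * B by apply: (le_trans (ler_normD _ _)); have := B1; lra.
have n4 : n%:R <= 4 ^+ n :> rat by rewrite -natrX ler_nat ltnW // ltn_expl.
have n0 : 0 <= 4 ^+ n :> rat by rewrite exprn_ge0.
apply: (@le_trans _ _ (B ^+ 2 * (`|p.1 + p.2| * `|R|) + B ^+ 2 * (`|p.2| * `|pder s|))).
  by rewrite -mulrDr ler_wpM2l ?exprn_ge0 // -!normrM ler_normD.
have e1 : B ^+ 2 * (`|p.1 + p.2| * `|R|) <= 2 * B * (4 ^+ n * B ^+ n).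
  by rewrite mulrCA ler_pM // ?mulr_ge0 ?exprn_ge0.
have e2 : B ^+ 2 * (`|p.2| * `|pder s|) <= B * (4 ^+ n * B ^+ n).
  rewrite expr2 -mulrA ler_wpM2l //; apply: (@le_trans _ _ (B * `|pder s|)).
    by rewrite ler_wpM2l // -[X in _ <= X]mul1r ler_wpM2r.
  by apply: (le_trans dh); rewrite ler_wpM2r.
apply: (le_trans (lerD e1 e2)); rewrite !exprS.
have : 0 <= B * (4 ^+ n * B ^+ n) by rewrite !mulr_ge0.
set Z := B * (_ * _) => Z0.
have -> : 4 * 4 ^+ n * (B * B ^+ n) = 4 * Z by rewrite /Z; ring.
have -> : 2 * B * (4 ^+ n * B ^+ n) = 2 * Z by rewrite /Z; ring.
lra.
Qed.
End ProductDerivative.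

(** * Elementary symmetric sums in Aomoto's identity *)

Lemma sum_antisym (T : finType) (S : {set T}) (f : T -> T -> rat) :
  2 * (\sum_(i in S) \sum_(j in S | j != i) f i j) =
  \sum_(i in S) \sum_(j in S | j != i) (f i j + f j i).
Proof.
under [RHS]eq_bigr => i _ do rewrite big_split /=.
rewrite big_split /= mulrDl !mul1r; congr (_ + _).
rewrite (exchange_big_dep (mem S)) /=; last by move=> i j _ /andP[].
by apply: eq_bigr => i iS; apply: eq_bigl => j; rewrite iS eq_sym.
Qed.

Lemma sum_offdiag (T : finType) (S : {set T}) (c : T -> rat) :
  \sum_(i in S) \sum_(j in S | j != i) c i = (#|S|%:R - 1) * \sum_(i in S) c i.
Proof.
rewrite mulr_sumr; apply: eq_bigr => i iS.
rewrite sumr_const.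
have -> : #|[pred j in S | j != i]| = #|S :\ i| by apply: eq_card => j; rewrite !inE andbC.
by rewrite (cardsD1 i S) iS natrD addrAC subrr add0r mulr_natl.
Qed.

Section ElementarySums.
Variables (T : finType) (u : T -> rat) (Q : rat).
Hypothesis u_inj : forall i j, i != j -> u i != u j.

Definition esym k : rat := \sum_(M : {set T} | #|M| == k) \prod_(j in M) u j.

(** Pairs (M, i) with i outside M correspond to pairs (K, i) with i in K, through K = M + {i}. *)
Lemma sum_setU1 k (G : {set T} -> T -> rat) :
  \sum_(M : {set T} | #|M| == k) \sum_(i in ~: M) G M i =
  \sum_(K : {set T} | #|K| == k.+1) \sum_(i in K) G (K :\ i) i.
Proof.
rewrite !pair_big_dep /=.
rewrite (reindex_onto (fun p : {set T} * T => (p.1 :\ p.2, p.2))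
   (fun p : {set T} * T => (p.2 |: p.1, p.2))) /=.
  apply: eq_bigl => -[K i]; rewrite !inE eqxx andbT /= xpair_eqE eqxx andbT /=.
  apply/andP/andP => [[/eqP h1 /eqP h2]|[/eqP h1 h2]].
    have iK : i \in K by rewrite -h2 !inE eqxx.
    by rewrite iK (cardsD1 i) iK h1.
  by split; [move: h1; rewrite (cardsD1 i) h2 add1n => -[->]|rewrite setD1K].
move=> [M i] /= /andP[_]; rewrite !inE => iM; congr (_, _).
by apply/setP => j; rewrite !inE; case: eqP => [->|] //=; rewrite (negbTE iM).
Qed.

Lemma esym_rec k : \sum_(M : {set T} | #|M| == k) \sum_(i in ~: M) (\prod_(j in M) u j * u i) =
  k.+1%:R * esym k.+1.
Proof.
rewrite (sum_setU1 k (fun M i => \prod_(j in M) u j * u i)) mulr_sumr.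
apply: eq_bigr => K /eqP cK; rewrite -cK mulr_natl -sumr_const; apply: eq_bigr => i iK.
by rewrite [RHS](big_setD1 i) //= mulrC.
Qed.

Lemma esym_compl k : \sum_(M : {set T} | #|M| == k) \sum_(i in ~: M) \prod_(j in M) u j =
  (#|T|%:R - k%:R) * esym k.
Proof.
rewrite mulr_sumr; apply: eq_bigr => M /eqP cM.
rewrite sumr_const -[_ *+ _]mulr_natl; congr (_ * _).
by rewrite -(cardsC M) cM natrD addrAC subrr add0r.
Qed.

(** Exchanging i and j, both outside M, cancels the denominator: the two terms u_i (Q - u_i) / (u_i
    - u_j) add up to Q - u_i - u_j. *)
Lemma interaction_out k :
  2 * \sum_(M : {set T} | #|M| == k) \sum_(i in ~: M) \sum_(j in ~: M | j != i)
     (\prod_(l in M) u l * (u i * (Q - u i) / (u i - u j))) =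
  (#|T|%:R - k%:R) * (#|T|%:R - k%:R - 1) * Q * esym k
    - 2 * (#|T|%:R - k%:R - 1) * k.+1%:R * esym k.+1.
Proof.
have -> : - (2 * (#|T|%:R - k%:R - 1) * k.+1%:R * esym k.+1) =
   - (2 * (#|T|%:R - k%:R - 1)) * (k.+1%:R * esym k.+1) by ring.
rewrite -esym_rec.
have -> : (#|T|%:R - k%:R) * (#|T|%:R - k%:R - 1) * Q * esym k =
   (#|T|%:R - k%:R - 1) * Q * ((#|T|%:R - k%:R) * esym k) by ring.
rewrite -esym_compl !mulr_sumr -big_split /=; apply: eq_bigr => M /eqP cM.
set p := \prod_(l in M) u l.
rewrite sum_antisym.
transitivity (\sum_(i in ~: M) \sum_(j in ~: M | j != i) (p * (Q - u i) + p * (- u j))).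
  apply: eq_bigr => i _; apply: eq_bigr => j /andP[_ ji].
  have uij : u i - u j != 0 by rewrite subr_eq0 u_inj // eq_sym.
  have uji : u j - u i != 0 by rewrite subr_eq0 u_inj.
  by field; rewrite uij uji.
under [LHS]eq_bigr => i _ do rewrite big_split /=.
rewrite big_split /= sum_offdiag.
rewrite (exchange_big_dep (mem (~: M))) /=; last by move=> i j _ /andP[].
have -> : \sum_(j in ~: M) \sum_(i in ~: M | (j \in ~: M) && (j != i)) p * - u j =
   \sum_(j in ~: M) \sum_(i in ~: M | i != j) p * - u j.
  by apply: eq_bigr => j jM; apply: eq_bigl => i; rewrite jM eq_sym.
rewrite (sum_offdiag (~: M) (fun j => p * - u j)).
have -> : #|~: M|%:R = #|T|%:R - k%:R :> rat.
  by rewrite -(cardsC M) cM natrD addrAC subrr add0r.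
rewrite !mulr_sumr -!big_split /=.
by apply: eq_bigr => i _; rewrite /=; ring.
Qed.

(** Here u_i is absorbed into the product over K = M + {i}; the remaining (Q - u_i) / (u_i - u_j)
    and its mirror image add up to -1, for each of the (k+1) k ordered pairs in K. *)
Lemma interaction_in k :
  2 * \sum_(M : {set T} | #|M| == k) \sum_(i in ~: M) \sum_(j in M)
     (\prod_(l in M) u l * (u i * (Q - u i) / (u i - u j))) =
  - (k.+1%:R * k%:R * esym k.+1).
Proof.
rewrite (sum_setU1 k (fun M i => \sum_(j in M)
     (\prod_(l in M) u l * (u i * (Q - u i) / (u i - u j))))).
rewrite mulr_sumr -mulNr mulr_sumr; apply: eq_bigr => K /eqP cK.
set p := \prod_(l in K) u l.
transitivity (2 * \sum_(i in K) \sum_(j in K | j != i) (p * ((Q - u i) / (u i - u j)))).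
  congr (_ * _); apply: eq_bigr => i iK.
  apply: eq_big => [j|j _]; first by rewrite !inE andbC.
  by rewrite /p (big_setD1 i iK) /=; ring.
rewrite sum_antisym.
transitivity (\sum_(i in K) \sum_(j in K | j != i) (- p)).
  apply: eq_bigr => i _; apply: eq_bigr => j /andP[_ ji].
  have uij : u i - u j != 0 by rewrite subr_eq0 u_inj // eq_sym.
  have uji : u j - u i != 0 by rewrite subr_eq0 u_inj.
  by field; rewrite uij uji.
rewrite sum_offdiag sumr_const cK -mulr_natl -natr1 /=; ring.
Qed.

(** With a = s + 1, b = r + s + 2, g = m and x_i = Q - u_i, the bracket is the negative of the one
    in [pder_facs]. The factor 2 on the left pays for the two symmetrisations. *)
Lemma aomoto_identity (a b g : rat) k :
  2 * \sum_(M : {set T} | #|M| == k) \sum_(i in ~: M) (\prod_(l in M) u l *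
     (a * Q - b * u i + g * \sum_(j | j != i) u i * (Q - u i) / (u i - u j))) =
  (#|T|%:R - k%:R) * (2 * a + g * (#|T|%:R - k%:R - 1)) * Q * esym k
  - k.+1%:R * (2 * b + g * (k%:R + 2 * (#|T|%:R - k%:R - 1))) * esym k.+1.
Proof.
have -> : \sum_(M : {set T} | #|M| == k) \sum_(i in ~: M) (\prod_(l in M) u l *
     (a * Q - b * u i + g * \sum_(j | j != i) u i * (Q - u i) / (u i - u j))) =
  a * Q * \sum_(M : {set T} | #|M| == k) \sum_(i in ~: M) \prod_(j in M) u j
  - b * \sum_(M : {set T} | #|M| == k) \sum_(i in ~: M) (\prod_(j in M) u j * u i)
  + g * \sum_(M : {set T} | #|M| == k) \sum_(i in ~: M) \sum_(j in ~: M | j != i)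
     (\prod_(l in M) u l * (u i * (Q - u i) / (u i - u j)))
  + g * \sum_(M : {set T} | #|M| == k) \sum_(i in ~: M) \sum_(j in M)
     (\prod_(l in M) u l * (u i * (Q - u i) / (u i - u j))).
  rewrite -mulNr !mulr_sumr -!big_split /=; apply: eq_bigr => M _.
  rewrite !mulr_sumr -!big_split /=; apply: eq_bigr => i iM.
  have -> : \sum_(j | j != i) u i * (Q - u i) / (u i - u j) =
      \sum_(j in M) u i * (Q - u i) / (u i - u j) +
      \sum_(j in ~: M | j != i) u i * (Q - u i) / (u i - u j).
    rewrite (bigID (mem M)) /=; congr (_ + _); apply: eq_bigl => j; last by rewrite inE andbC.
    case: (boolP (j \in M)) => jM; rewrite ?andbF // andbT.
    by apply/eqP => e; move: iM; rewrite -e inE jM.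
  by rewrite -!(mulr_sumr _ _ _ (\prod_(l in M) u l)); ring.
set X := \sum_(M | _) _; set Y := \sum_(M | _) _; set Z := \sum_(M | _) _; set W := \sum_(M | _) _.
have -> : 2 * (a * Q * X - b * Y + g * Z + g * W) =
  2 * a * Q * X - 2 * b * Y + g * (2 * Z) + g * (2 * W) by ring.
by rewrite /X /Y /Z /W esym_compl esym_rec interaction_out interaction_in; ring.
Qed.
End ElementarySums.

(** * The discrete Aomoto recursion *)

Section Flat.
Variables (I : eqType) (A : eqType).
(** Repetition encodes a k-th power as a list of linear factors, the form required by [pval] and
    [pder]. *)
Definition flat k (f : I -> A) (l : seq I) : seq A := flatten [seq nseq k (f j) | j <- l].

Lemma flat_cons k f j l : flat k f (j :: l) = nseq k (f j) ++ flat k f l.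
Proof. by []. Qed.

Lemma big_flat_sum k f l (c : A -> rat) :
  \sum_(p <- flat k f l) c p = k%:R * \sum_(j <- l) c (f j).
Proof.
elim: l => [|j l IH]; first by rewrite !big_nil mulr0.
by rewrite flat_cons big_cat IH big_cons mulrDr big_nseq iter_addr_0 -[_ *+ k]mulr_natl.
Qed.

Lemma big_flat_prod k f l (c : A -> rat) :
  \prod_(p <- flat k f l) c p = (\prod_(j <- l) c (f j)) ^+ k.
Proof.
elim: l => [|j l IH]; first by rewrite !big_nil expr1n.
by rewrite flat_cons big_cat IH big_cons exprMn big_nseq iter_mulr_1.
Qed.

Lemma size_flat k f l : size (flat k f l) = (size l * k)%N.
Proof. by elim: l => // j l IH; rewrite flat_cons size_cat size_nseq IH. Qed.

Lemma mem_flat k f l p : p \in flat k f l -> exists2 j, j \in l & p = f j.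
Proof.
by case/flattenP => t /mapP[j jl ->]; rewrite mem_nseq => /andP[_ /eqP ->]; exists j.
Qed.

Lemma flat_mem k f l j : (0 < k)%N -> j \in l -> f j \in flat k f l.
Proof.
move=> k0 jl; apply/flattenP; exists (nseq k (f j)); first by apply/mapP; exists j.
by rewrite mem_nseq k0 eqxx.
Qed.
End Flat.

Lemma map_flat (I A C : eqType) (g : A -> C) k (f : I -> A) l :
  map g (flat k f l) = flat k (g \o f) l.
Proof. by elim: l => // j l IH; rewrite !flat_cons map_cat map_nseq IH. Qed.

Lemma eq_flat (I A : eqType) k (f g : I -> A) l : f =1 g -> flat k f l = flat k g l.
Proof. by move=> e; elim: l => // j l IH; rewrite !flat_cons IH e. Qed.

Section Selberg.
Variable n : nat.
Implicit Types x : {ffun 'I_n -> nat}.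

Definition ordx x := [forall i : 'I_n, forall j : 'I_n, (i < j)%N ==> (x i < x j)%N].

Lemma ordxP x : reflect (forall i j : 'I_n, (i < j)%N -> (x i < x j)%N) (ordx x).
Proof.
apply: (iffP forallP) => [h i j ij|h i]; first by move: (h i) => /forallP/(_ j)/implyP; apply.
by apply/forallP => j; apply/implyP; apply: h.
Qed.

Lemma ordx_inj x i j : ordx x -> i != j -> x i != x j.
Proof.
move/ordxP => h ij; have : nat_of_ord i != j by [].
by rewrite neq_ltn => /orP[] /h; rewrite neq_ltn => -> //; rewrite orbT.
Qed.

Definition pairs : seq ('I_n * 'I_n) := [seq p : 'I_n * 'I_n <- enum {: 'I_n * 'I_n} | (p.1 < p.2)%N].

Lemma mem_pairs p : (p \in pairs) = (p.1 < p.2)%N.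
Proof. by rewrite mem_filter mem_enum andbT. Qed.

Lemma big_pairs (R : Type) (idx : R) (op : Monoid.com_law idx) (F : 'I_n * 'I_n -> R) :
  \big[op/idx]_(p <- pairs) F p = \big[op/idx]_(l < n) \big[op/idx]_(j < n | (j < l)%N) F (j, l).
Proof.
rewrite big_filter big_enum_cond /=.
transitivity (\big[op/idx]_(p : 'I_n * 'I_n | true && (p.1 < p.2)%N) F (p.1, p.2)).
  by apply: eq_bigr => -[].
rewrite -(pair_big_dep xpredT (fun j l : 'I_n => (j < l)%N) (fun j l => F (j, l))) /=.
by rewrite (exchange_big_dep xpredT).
Qed.

Lemma size_pairs : size pairs = 'C(n, 2).
Proof.
rewrite -sum1_size big_pairs /= -bin2_sum big_mkord; apply: eq_bigr => l _.
by rewrite (big_ord_narrow (ltnW (ltn_ord l))) sum1_card card_ord.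
Qed.

Definition vdm x : rat := \prod_(p <- pairs) ((x p.2)%:R - (x p.1)%:R).

(** No absolute value is taken for odd [m]: the weight is summed over increasing [x] only, where
    [vdm x] is positive. *)
Definition weight m r s q x : rat :=
  (\prod_j (x j)%:R ^+ r) * (\prod_j (q%:R - (x j)%:R) ^+ s) * vdm x ^+ m.

Variables m r s : nat.
Hypothesis m_gt0 : (0 < m)%N.

(** The factors of x_i u_i times the product of u_j over M times the weight, each with its increment
    under x_i -> x_i + 1. The two leading factors vanish at x_i = 0 and x_i = q. *)
Definition facs q i (M : {set 'I_n}) x : seq (rat * rat) :=
  ((x i)%:R, 1) :: (q%:R - (x i)%:R, -1)
  :: [seq (q%:R - (x j)%:R, - (j == i)%:R) | j <- enum M]
  ++ flat r (fun j => ((x j)%:R, (j == i)%:R)) (enum 'I_n)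
  ++ flat s (fun j => (q%:R - (x j)%:R, - (j == i)%:R)) (enum 'I_n)
  ++ flat m (fun p => ((x p.2)%:R - (x p.1)%:R, (p.2 == i)%:R - (p.1 == i)%:R)) pairs.

Definition wdeg : nat := (n * r + n * s + 'C(n, 2) * m)%N.

Lemma size_facs q i M x : size (facs q i M x) = (#|M| + wdeg).+2.
Proof.
by rewrite /= !size_cat size_map -cardE !size_flat size_enum_ord size_pairs /wdeg !addnA.
Qed.

Lemma pval_flat (I : eqType) k (f : I -> rat * rat) l :
  pval (flat k f l) = (\prod_(j <- l) (f j).1) ^+ k.
Proof. exact: big_flat_prod. Qed.

Lemma prod_enum_exp k (f : 'I_n -> rat) : (\prod_(j <- enum 'I_n) f j) ^+ k = \prod_j f j ^+ k.
Proof. by rewrite big_enum prodrXl. Qed.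

Lemma pval_facs q i M x : pval (facs q i M x) =
  (x i)%:R * (q%:R - (x i)%:R) * (\prod_(j in M) (q%:R - (x j)%:R)) * weight m r s q x.
Proof.
rewrite /facs !pval_cons !pval_cat !pval_flat /= !prod_enum_exp.
by rewrite {1}/pval big_map big_enum /weight /vdm /=; ring.
Qed.

Lemma pshift_facs q i M x : pshift (facs q i M x) = pval (facs q i M (upd x i (x i).+1)).
Proof.
rewrite /pshift /pval -(big_map (fun p => p.1 + p.2) xpredT id) -(big_map fst xpredT id).
congr (\prod_(a <- _) a).
have e j : (upd x i (x i).+1 j)%:R = (x j)%:R + (j == i)%:R :> rat.
  by rewrite ffunE; case: eqP => [->|_]; rewrite ?addr0 // -natr1.
rewrite /facs /= !map_cat !map_flat -!map_comp e eqxx.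
congr [:: _, _ & _ ++ (_ ++ (_ ++ _))].
- by rewrite opprD addrA.
- by apply: eq_map => j /=; rewrite e opprD addrA.
- by apply: eq_flat => j /=; rewrite e.
- by apply: eq_flat => j /=; rewrite e opprD addrA.
- by apply: eq_flat => j /=; rewrite !e; ring.
Qed.

(** The sign records whether i is the larger or the smaller member of the pair; antisymmetry of [f]
    merges the two cases. *)
Lemma sum_pairs_at i (f : 'I_n -> 'I_n -> rat) : (forall j l, f j l = - f l j) ->
  \sum_(p <- pairs) ((p.2 == i)%:R - (p.1 == i)%:R) * f p.2 p.1 = \sum_(j | j != i) f i j.
Proof.
move=> fa; rewrite big_pairs /=.
under eq_bigr => l _ do under eq_bigr => j _ do rewrite mulrBl.
under eq_bigr => l _ do rewrite big_split /=.
rewrite big_split /=.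
have -> : \sum_(l < n) \sum_(j < n | (j < l)%N) (l == i)%:R * f l j =
    \sum_(j < n | (j < i)%N) f i j.
  rewrite (bigD1 i) //= [X in _ + X]big1 ?addr0; last first.
    by move=> l /negbTE ->; rewrite big1 // => j _; rewrite mul0r.
  by apply: eq_bigr => j _; rewrite eqxx mul1r.
rewrite (exchange_big_dep xpredT) //=.
have -> : \sum_(j < n) \sum_(l < n | (j < l)%N) - ((j == i)%:R * f l j) =
    \sum_(l < n | (i < l)%N) f i l.
  rewrite (bigD1 i) //= [X in _ + X]big1 ?addr0; last first.
    by move=> l /negbTE ->; rewrite big1 // => j _; rewrite mul0r oppr0.
  by apply: eq_bigr => j _; rewrite eqxx mul1r -fa.
rewrite [RHS](bigID (fun j : 'I_n => (j < i)%N)) /=; congr (_ + _); apply: eq_bigl => j.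
  by rewrite -val_eqE /=; case: ltngtP.
by rewrite -val_eqE /=; case: ltngtP.
Qed.

(** The prefactor x_i u_i clears the poles 1/x_i and 1/u_i of the logarithmic derivative, so x_i = 0
    is harmless. Its own derivative u_i - x_i raises r and s to r + 1 and s + 1. The differences x_i
    - x_j that remain are nonzero on increasing [x]. *)
Lemma pder_facs q i (M : {set 'I_n}) x : i \notin M -> ordx x ->
  pder (facs q i M x) = (\prod_(j in M) (q%:R - (x j)%:R)) * weight m r s q x *
    (r.+1%:R * (q%:R - (x i)%:R) - s.+1%:R * (x i)%:R +
     m%:R * \sum_(j | j != i) (x i)%:R * (q%:R - (x i)%:R) / ((x i)%:R - (x j)%:R)).
Proof.
move=> iM ox; rewrite /facs /= !pder_cat !pval_cons !pval_cat /=.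
set LM := [seq _ | j <- enum M]; set LX := flat r _ _; set LU := flat s _ _; set LV := flat m _ _.
have -> : pder LM = 0.
  rewrite -[pder LM]mul1r (pder_prop (c := fun=> 0)); first by rewrite big1 // mul0r.
  move=> p /mapP[j]; rewrite mem_enum => jM -> /=.
  have /negbTE -> : j != i by apply: contraNneq iM => <-.
  by rewrite oppr0 mulr0 mul0r.
have hX : (x i)%:R * pder LX = r%:R * pval LX.
  rewrite (pder_prop (c := snd)); last first.
    by move=> p /mem_flat [j _ ->] /=; case: eqP => [->|]; rewrite ?mulr0 ?mul0r // mulrC.
  rewrite big_flat_sum /=; congr (_ * _).
  rewrite -[RHS]mulr1; congr (_ * _).
  by rewrite big_enum (bigD1 i) //= eqxx big1 ?addr0 // => j /negbTE ->.
have hU : (q%:R - (x i)%:R) * pder LU = - s%:R * pval LU.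
  rewrite (pder_prop (c := snd)); last first.
    by move=> p /mem_flat [j _ ->] /=; case: eqP => [->|]; rewrite ?oppr0 ?mulr0 ?mul0r // mulrC.
  rewrite big_flat_sum /=; congr (_ * _).
  rewrite -[RHS]mulr1 mulNr -mulrN; congr (_ * _).
  by rewrite big_enum (bigD1 i) //= eqxx big1 ?addr0 // => j /negbTE ->; rewrite oppr0.
have hV : pder LV = m%:R * (\sum_(j | j != i) ((x i)%:R - (x j)%:R)^-1) * pval LV.
  rewrite -[pder LV]mul1r (pder_prop (c := fun p => p.2 / p.1)); last first.
    move=> p /mem_flat [j]; rewrite mem_pairs => h -> /=.
    rewrite mul1r mulfVK // subr_eq0 eqr_nat; apply: ordx_inj => //.
    by rewrite -val_eqE neq_ltn h orbT.
  rewrite big_flat_sum /= (sum_pairs_at i (f := fun j l => ((x j)%:R - (x l)%:R)^-1)) //.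
  by move=> j l; rewrite -invrN opprB.
have -> : \prod_(j in M) (q%:R - (x j)%:R) * weight m r s q x =
    pval LM * pval LX * pval LU * pval LV.
  rewrite !pval_flat /= !prod_enum_exp /pval big_map big_enum /weight /vdm /=; ring.
rewrite hV -mulr_sumr -!natr1.
set S := \sum_(j | _) _; set a := (x i)%:R; set u := q%:R - a.
transitivity (pval LM * pval LX * pval LU * pval LV * (u - a) +
   u * pval LM * pval LU * pval LV * (a * pder LX) +
   a * pval LM * pval LX * pval LV * (u * pder LU) +
   a * u * pval LM * pval LX * pval LU * (m%:R * S * pval LV)); first by ring.
by rewrite hX hU; ring.
Qed.

Lemma facs_bounded q i M x : (forall j, x j <= q)%N -> pbounded q.+1%:R (facs q i M x).
Proof.
move=> h.
have h0 j : 0 <= (x j)%:R :> rat by rewrite ler0n.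
have h1 j : (x j)%:R <= q%:R :> rat by rewrite ler_nat.
have e : q.+1%:R = q%:R + 1 :> rat by rewrite -natr1.
have b (c : bool) : `|c%:R : rat| <= 1 by case: c; rewrite ?normr1 ?normr0.
have bx j : `|(x j)%:R : rat| <= q.+1%:R.
  by rewrite e ger0_norm //; have := h0 j; have := h1 j; lra.
have bu j : `|q%:R - (x j)%:R : rat| <= q.+1%:R.
  by rewrite e ger0_norm; have := h0 j; have := h1 j; lra.
move=> p; rewrite !inE !mem_cat.
case/or3P => [/eqP ->|/eqP ->|] /=; rewrite ?normrN ?normr1 //.
case/or4P => [/mapP[j _ ->]|/mem_flat[j _ ->]|/mem_flat[j _ ->]|/mem_flat[j]] /=; rewrite ?normrN //.
rewrite mem_pairs => hj -> /=; split.
  by rewrite ler_norml e; have := h0 j.1; have := h1 j.1; have := h0 j.2; have := h1 j.2 => *; apply/andP; split; lra.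
by case: (_ == i); case: (_ == i); rewrite ?subrr ?subr0 ?sub0r ?normrN ?normr0 ?normr1.
Qed.
End Selberg.

Section Aomoto.
Variables n m r s : nat.
Hypothesis m_gt0 : (0 < m)%N.
Implicit Types x : {ffun 'I_n -> nat}.
Notation deg := (wdeg n m r s).
Notation facs := (facs m r s).

(** Since m > 0, the Vandermonde factor of the close pair occurs in the list; being at most 1 in
    absolute value, it saves one power of q + 1. *)
Lemma pval_facs_near q i (M : {set 'I_n}) x j : (forall l, x l <= q)%N -> j != i ->
  (x i <= (x j).+1)%N -> (x j <= (x i).+1)%N ->
  `|pval (facs q i M x)| <= q.+1%:R ^+ (#|M| + deg).+1.
Proof.
move=> xq ji h1 h2; pose p := if (i < j)%N then (i, j) else (j, i).
have hp : p \in pairs n.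
  rewrite mem_pairs /p; case: ifP => //= ij.
  by have : nat_of_ord j != i := ji; rewrite neq_ltn ij orbF.
pose a0 : rat := (x p.2)%:R - (x p.1)%:R.
have -> : (#|M| + deg).+1 = (size [seq p.1 | p <- facs q i M x]).-1.
  by rewrite size_map size_facs.
rewrite /pval -(big_map fst xpredT id); apply: (prod_le_pow_pred (a0 := a0)).
- apply/mapP; exists (a0, (p.2 == i)%:R - (p.1 == i)%:R) => //.
  rewrite /facs !inE !mem_cat; apply/or3P/Or33; rewrite !orbA; apply/orP; right.
  exact: (flat_mem (fun p : 'I_n * 'I_n =>
    ((x p.2)%:R - (x p.1)%:R : rat, (p.2 == i)%:R - (p.1 == i)%:R : rat)) m_gt0 hp).
- have h1' : (x i)%:R <= (x j)%:R + 1 :> rat by rewrite natr1 ler_nat.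
  have h2' : (x j)%:R <= (x i)%:R + 1 :> rat by rewrite natr1 ler_nat.
  by rewrite /a0 /p ler_norml; case: ifP => _ /=; apply/andP; split; lra.
- by move=> a /mapP[t /facs_bounded-/(_ xq) [] ? _ ->].
Qed.

Lemma ordx_shift x i : ~~ near_collision i x -> ordx (upd x i (x i).+1) = ordx x.
Proof.
rewrite /near_collision negb_exists => /forallP h.
have h' j : j != i -> x i != x j /\ (x i).+1 != x j.
  by move=> ji; move: (h j); rewrite ji /= negb_or => /andP[].
apply: eq_forallb => a; apply: eq_forallb => b; rewrite !ffunE.
case: ltnP => //= ab; case: eqP => [ea|/eqP na]; case: eqP => [eb|/eqP nb] //.
- by move: ab; rewrite ea eb ltnn.
- by rewrite ea; have [h1 h2] := h' b nb; lia.
- by rewrite eb; have [h1 h2] := h' a na; lia.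
Qed.

(** One power below the trivial bound: a derivative of |M| + deg + 2 factors, summed over n
    coordinates, could have order n + |M| + deg + 1. Up to the Taylor remainder the derivative is a
    difference that telescopes to 0; near collisions each term is bounded separately and the rarity
    of the points saves the power. *)
Lemma aomoto_term i (M : {set 'I_n}) :
  bigO (n + (#|M| + deg)) (fun q => \sum_(x <- box 'I_n q | ordx x) pder (facs q i M x)).
Proof.
set d := (#|M| + deg)%N.
(* [K1] is the Taylor constant for d + 2 factors. [K2] bounds the three terms near a collision: 1
   for each of the two products and d + 2 for the derivative. The factor 2 n comes from
   [count_near_collision]. *)
pose K1 : rat := 4 ^+ d.+2; pose K2 : rat := 2 + d.+2%:R.
exists (K1 + K2 * (2 * n%:R)) => q.
have K20 : 0 <= K2 by rewrite addr_ge0.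
case: q => [|q].
  rewrite big_box big_pred0; last by move=> x; case: (x i).
  have K0 : 0 <= K1 + K2 * (2 * n%:R) by apply: addr_ge0; rewrite ?exprn_ge0 // !mulr_ge0.
  by rewrite normr0 mulr_ge0 // exprn_ge0.
move: q.+1 (ltn0Sn q) => {}q q0.
set B : rat := q.+1%:R; have B1 : 1 <= B by rewrite ler1n.
have B0 : 0 < B by apply: lt_le_trans B1.
pose H x := (ordx x)%:R * pval (facs q i M x).
have tele : \sum_(x <- box 'I_n q) (H (upd x i (x i).+1) - H x) = 0.
  apply: box_telescope => x; rewrite /H pval_facs upd_same ?subrr ?mulr0n ?mulr0 ?mul0r ?mulr0 //.
have ptw x : x \in box 'I_n q ->
   `|H (upd x i (x i).+1) - H x - (ordx x)%:R * pder (facs q i M x)| <=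
      K1 * B ^+ d + K2 * B ^+ d.+1 * (near_collision i x)%:R.
  rewrite mem_box => /forallP xq.
  have xq1 l : (x l <= q)%N by apply: ltnW.
  have xq2 l : (upd x i (x i).+1 l <= q)%N by rewrite ffunE; case: eqP => // _; apply: xq.
  have fb : pbounded B (facs q i M x) by apply: facs_bounded.
  case: (boolP (near_collision i x)) => nc; last first.
    rewrite mulr0 addr0 /H ordx_shift // -pshift_facs -!mulrBr normrM.
    have e2 := pshift_expand B1 fb.
    rewrite size_facs -/d -(add2n d) (exprD B) [X in _ <= X]mulrCA ler_pM2l ?exprn_gt0 // in e2.
    apply: le_trans e2; rewrite -[X in _ <= X]mul1r ler_pM //; last first.
    by case: (ordx x); rewrite ?normr1 ?normr0.
  have b01 (b : bool) (z : rat) c : `|z| <= c -> `|b%:R * z| <= c.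
    by move=> h; rewrite normrM; case: b; rewrite ?normr1 ?mul1r ?normr0 ?mul0r // (le_trans _ h).
  have hd : `|pder (facs q i M x)| <= d.+2%:R * B ^+ d.+1.
    by have := pder_bound B1 fb; rewrite size_facs -/d exprS mulrCA ler_pM2l.
  have [j /andP[ji hj]] := existsP nc.
  have h1 : `|pval (facs q i M x)| <= B ^+ d.+1.
    by apply: pval_facs_near ji _ _ => //; case/orP: hj => /eqP <-; do ?[exact: leqnn | apply: leqW].
  have h2 : `|pval (facs q i M (upd x i (x i).+1))| <= B ^+ d.+1.
    have := @pval_facs_near q i M _ j xq2 ji; rewrite upd_same (upd_neq _ _ ji).
    by apply; case/orP: hj => /eqP <-; do ?[exact: leqnn | apply: leqW].
  apply: (@le_trans _ _ (K2 * B ^+ d.+1)); last first.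
    by rewrite mulr1 lerDr mulr_ge0 // ?exprn_ge0 // ltW.
  apply: (le_trans (ler_normB _ _)); rewrite /K2 mulrDl lerD ?b01 //.
  apply: (le_trans (ler_normB _ _)); rewrite mulrDl mul1r lerD // b01 //.
have -> : \sum_(x <- box 'I_n q | ordx x) pder (facs q i M x) =
   - \sum_(x <- box 'I_n q) (H (upd x i (x i).+1) - H x - (ordx x)%:R * pder (facs q i M x)).
  rewrite sumrB tele sub0r opprK [LHS]big_mkcond; apply: eq_bigr => x _.
  by case: ifP; rewrite ?mul1r ?mul0r.
rewrite normrN; apply: (le_trans (ler_norm_sum _ _ _)).
rewrite big_seq; apply: (le_trans (ler_sum _ ptw)); rewrite -big_seq big_split /= -mulr_sumr.
rewrite big_const_seq count_predT size_box card_ord iter_addr_0 -[_ *+ (_ ^ _)]mulr_natr natrX.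
have cnt := count_near_collision i q0; rewrite card_ord in cnt.
have n0 : n = n.-1.+1 by rewrite prednK //; case: (i) => ? /(leq_ltn_trans _); apply.
have qB k : q%:R ^+ k <= B ^+ k by apply: lerXn2r; rewrite ?nnegrE ?ler0n // ler_nat.
have K10 : 0 <= K1 by rewrite exprn_ge0.
have eB : B ^+ (n + d) = B ^+ d.+1 * B ^+ n.-1 by rewrite -exprD; congr (_ ^+ _); lia.
have Bd k : 0 <= B ^+ k by rewrite exprn_ge0 // ltW.
clearbody K1 K2; rewrite [X in _ <= X]mulrDl; apply: lerD.
  by apply: ler_wpM2l => //; rewrite exprD mulrC; apply: ler_wpM2r.
rewrite -mulr_sumr -!mulrA; apply: ler_wpM2l => //.
apply: (@le_trans _ _ (B ^+ d.+1 * (2 * n%:R * B ^+ n.-1))).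
  apply: ler_wpM2l => //; apply: (le_trans cnt); apply: ler_wpM2l => //.
  by rewrite mulr_ge0.
by rewrite eB mulrCA !mulrA.
Qed.

(** Interpolates between the Selberg sums for s (k = 0) and for s + 1 (k = n). *)
Definition esum k q : rat :=
  \sum_(x <- box 'I_n q | ordx x) esym (fun j => q%:R - (x j)%:R) k * weight m r s q x.

Definition anum k : rat := (n%:R - k%:R) * (2 * s.+1%:R + m%:R * (n%:R - k%:R - 1)).
Definition aden k : rat :=
  k.+1%:R * (2 * (r + s + 2)%:R + m%:R * (k%:R + 2 * (n%:R - k%:R - 1))).

(** Each of the two terms may have order n + k + deg + 1; the recursion says that they cancel to
    leading order. It is [aomoto_term] summed over all M of size k and all i outside M. *)
Lemma aomoto_rec k :
  bigO (n + (k + deg)) (fun q => anum k * q%:R * esum k q - aden k * esum k.+1 q).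
Proof.
have h : bigO (n + (k + deg)) (fun q => -2 * \sum_(M : {set 'I_n} | #|M| == k) \sum_(i in ~: M)
     \sum_(x <- box 'I_n q | ordx x) pder (facs q i M x)).
  apply: bigOZ; apply: bigO_sum => M /eqP <-; apply: bigO_sum => i _; exact: aomoto_term.
apply: eq_bigO h => q; rewrite /esum !mulr_sumr -sumrB.
under eq_bigr => M _ do rewrite exchange_big.
rewrite -mulr_sumr exchange_big mulr_sumr; apply: eq_bigr => x ox.
pose u j : rat := q%:R - (x j)%:R.
have ui i j : i != j -> u i != u j.
  move=> ij; rewrite /u; apply: contraNneq (ordx_inj ox ij) => /addrI /oppr_inj /eqP.
  by rewrite eqr_nat.
have := aomoto_identity q%:R ui s.+1%:R (r + s + 2)%:R m%:R k; rewrite card_ord.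
rewrite -/(anum k) -/(aden k) => e.
transitivity ((anum k * q%:R * esym u k - aden k * esym u k.+1) * weight m r s q x); last by ring.
rewrite -e mulNr -mulrN -mulrA; congr (_ * _).
rewrite -sumrN mulr_suml; apply: eq_bigr => M _.
rewrite -sumrN mulr_suml; apply: eq_bigr => i; rewrite inE => iM.
rewrite pder_facs //.
have -> : \sum_(j | j != i) (x i)%:R * (q%:R - (x i)%:R) / ((x i)%:R - (x j)%:R) =
  - \sum_(j | j != i) u i * (q%:R - u i) / (u i - u j).
  rewrite -sumrN; apply: eq_bigr => j _; rewrite /u -mulrN -invrN; congr (_ / _); ring.
by rewrite /u -!natr1 !natrD; ring.
Qed.

Definition tsum q : rat := \sum_(x <- box 'I_n q | ordx x) weight m r s q x.

Lemma esum0 q : esum 0 q = tsum q.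
Proof.
apply: eq_bigr => x _; rewrite /esym (big_pred1 set0) ?big_set0 ?mul1r // => M.
by rewrite cards_eq0.
Qed.
End Aomoto.

Lemma esumn n m r s q : esum n m r s n q = tsum n m r s.+1 q.
Proof.
apply: eq_bigr => x _; rewrite /esym (big_pred1 setT).
  rewrite (eq_bigl xpredT) => [|j]; last by rewrite inE.
  rewrite /weight.
  under [X in _ = _ * X * _]eq_bigr => j _ do rewrite exprS.
  by rewrite big_split /=; ring.
move=> M; rewrite /= eqEcard subsetT cardsT card_ord /= eqn_leq.
by have := max_card (mem M); rewrite card_ord => ->.
Qed.

(** * The Selberg constant *)

Lemma dfactSS k : dfact k.+2 = (k.+2 * dfact k)%N.
Proof. by []. Qed.

Lemma dfact_neq0 k : (dfact k)%:R != 0 :> rat.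
Proof.
rewrite pnatr_eq0; have [l hl] : exists l, (k < l)%N by exists k.+1.
elim: l k hl => // l IH [|[|k]] // hk; rewrite dfactSS muln_eq0 negb_or /= IH //; lia.
Qed.

Lemma prod_ord_div (n : nat) (f g : 'I_n -> rat) :
  \prod_(i < n) (f i / g i) = (\prod_(i < n) f i) / \prod_(i < n) g i.
Proof. by rewrite big_split /= prodfV. Qed.

Section SelbergConstant.
Variable m : nat.

(** The Selberg integral over increasing points of [0, 1], with exponents r, s and m, in double
    factorials; [tsum_asym] justifies this reading. Inside the product n >= 1, so [n + j.+1 - 2]
    does not truncate. *)
Definition selberg n r s : rat :=
  (2 ^ n)%N%:R / (n`!)%:R *
  \prod_(j < n) ((dfact (j.+1 * m) * dfact (2 * r + j * m) * dfact (2 * s + j * m))%N%:R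
     / (dfact m * dfact (2 * r + 2 * s + 2 + (n + j.+1 - 2) * m))%N%:R).

(** After the reversal k -> n - 1 - k, the factors n - k of the numerators and k + 1 of the
    denominators both multiply to n! and cancel. What is left is the step by 2 of the double
    factorials. *)
Lemma aomoto_ratio n r s :
  \prod_(k < n) (anum n m s k / aden n m r s k) =
  \prod_(j < n) ((2 * s + j * m).+2%:R / (2 * r + 2 * s + 2 + (n + j.+1 - 2) * m).+2%:R).
Proof.
have hn (j : 'I_n) : ((n - j.+1)%N)%:R = n%:R - j%:R - 1 :> rat.
  by rewrite natrB // -natr1; ring.
rewrite !prod_ord_div (reindex_inj rev_ord_inj) /=.
rewrite [X in _ / X = _](eq_bigr (fun k : 'I_n => k.+1%:R * (2 * (r + s + 2)%:R +
     m%:R * (k%:R + 2 * (n%:R - k%:R - 1))))) //.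
rewrite [X in _ / X = _]big_split /=.
rewrite [X in _ / (_ * X) = _](reindex_inj rev_ord_inj) /=.
have -> : \prod_(j < n) anum n m s (n - j.+1) =
   (\prod_(j < n) j.+1%:R) * \prod_(j < n) (2 * s + j * m).+2%:R.
  rewrite -big_split /=; apply: eq_bigr => j _.
  rewrite /anum hn -!natr1 natrD !natrM; ring.
have -> : \prod_(j < n) (2 * (r + s + 2)%:R +
     m%:R * ((n - j.+1)%N%:R + 2 * (n%:R - (n - j.+1)%N%:R - 1))) =
   \prod_(j < n) (2 * r + 2 * s + 2 + (n + j.+1 - 2) * m).+2%:R :> rat.
  apply: eq_bigr => j _; rewrite hn.
  have e : (n + j.+1 - 2)%N%:R = n%:R + j%:R - 1 :> rat.
    rewrite natrB; last by have := ltn_ord j; lia.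
    by rewrite natrD -!natr1; ring.
  by rewrite -!natr1 !natrD !natrM e; ring.
have d0 : \prod_(j < n) j.+1%:R != 0 :> rat.
  by apply/prodf_neq0 => j _; rewrite pnatr_eq0.
by rewrite -mulf_div divff // mul1r.
Qed.

Lemma selbergS n r s :
  selberg n r s.+1 = selberg n r s * \prod_(k < n) (anum n m s k / aden n m r s k).
Proof.
rewrite aomoto_ratio /selberg -[RHS]mulrA -big_split; congr (_ * _).
apply: eq_bigr => j _; rewrite -[RHS]/(_ * _).
have -> : (2 * s.+1 + j * m = (2 * s + j * m).+2)%N by lia.
have -> : (2 * r + 2 * s.+1 + 2 + (n + j.+1 - 2) * m =
  (2 * r + 2 * s + 2 + (n + j.+1 - 2) * m).+2)%N by lia.
rewrite !dfactSS !natrM.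
have h1 := dfact_neq0 m; have h2 := dfact_neq0 (2 * r + 2 * s + 2 + (n + j.+1 - 2) * m).
have h3 : (2 * r + 2 * s + 2 + (n + j.+1 - 2) * m).+2%:R != 0 :> rat by rewrite pnatr_eq0.
move: h1 h2 h3; move: (_.+2%:R) (_.+2%:R) (dfact m)%:R (dfact (_ + _))%:R => *.
by field; apply/and3P.
Qed.

(** Constant counterpart of [tsum_rec]: summing y^r T_{n,r,m}(y) over y < q divides the leading
    coefficient by the new total degree. *)
Lemma selberg0 n r :
  selberg n.+1 r 0 = selberg n r m * (n.+1 * r.+1 + 'C(n.+1, 2) * m)%:R^-1.
Proof.
rewrite /selberg !prod_ord_div.
(* Both sides are products of these three families over overlapping ranges; they differ only by the
   end factors a 0, a 1, b n and e n, and [e n] is (2 r + n m + 2) [b n]. *)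
pose a j := (dfact (j * m))%:R : rat; pose b j := (dfact (2 * r + j * m))%:R : rat.
pose e j := (dfact (2 * r + 2 + j * m))%:R : rat.
have dpow k : (dfact m)%:R ^+ k = \prod_(j < k) (dfact m)%:R :> rat.
  by rewrite prodr_const card_ord.
have -> : \prod_(j < n.+1) (dfact (j.+1 * m) * dfact (2 * r + j * m) * dfact (2 * 0 + j * m))%:R =
   (a 1%N * \prod_(j < n) a j.+2) * ((\prod_(j < n) b j) * b n) * (a 0%N * \prod_(j < n) a j.+1).
  rewrite -[X in _ * X](big_ord_recl n (fun j : 'I_n.+1 => a j)).
  rewrite -[X in X * _ * _](big_ord_recl n (fun j : 'I_n.+1 => a j.+1)).
  rewrite -[X in _ * X * _](big_ord_recr n (fun j : 'I_n.+1 => b j)).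
  by rewrite -!big_split; apply: eq_bigr => j _; rewrite !natrM muln0 add0n.
have -> : \prod_(j < n.+1) (dfact m * dfact (2 * r + 2 * 0 + 2 + (n.+1 + j.+1 - 2) * m))%:R =
   (dfact m)%:R ^+ n.+1 * (e n * \prod_(j < n) e (n + j.+1)%N).
  transitivity ((dfact m)%:R ^+ n.+1 * \prod_(j < n.+1) e (n + j)%N).
    rewrite dpow -big_split; apply: eq_bigr => j _ /=.
    by rewrite natrM /e; congr (_ * (dfact (_ + _ * _))%:R); lia.
  by rewrite big_ord_recl addn0.
have -> : \prod_(j < n) (dfact (j.+1 * m) * dfact (2 * r + j * m) * dfact (2 * m + j * m))%:R =
   (\prod_(j < n) a j.+1) * (\prod_(j < n) b j) * (\prod_(j < n) a j.+2).
  rewrite -!big_split; apply: eq_bigr => j _ /=; rewrite !natrM /a.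
  by congr (_ * _ * (dfact _)%:R); lia.
have -> : \prod_(j < n) (dfact m * dfact (2 * r + 2 * m + 2 + (n + j.+1 - 2) * m))%:R =
   (dfact m)%:R ^+ n * (\prod_(j < n) e (n + j.+1)%N).
  rewrite dpow -big_split; apply: eq_bigr => j _ /=.
  rewrite natrM /e; congr (_ * (dfact _)%:R).
  have -> : (n + j.+1 = (n + j.+1 - 2) + 2)%N by have := ltn_ord j; lia.
  by rewrite addnK mulnDl; lia.
have -> : a 0%N = 1 by rewrite /a mul0n.
have -> : a 1%N = (dfact m)%:R by rewrite /a mul1n.
have he : e n = (2 * r + n * m).+2%:R * b n.
  by rewrite /e /b -natrM -dfactSS; congr (dfact _)%:R; lia.
have -> : (n.+1 * r.+1 + 'C(n.+1, 2) * m)%:R = n.+1%:R * (2 * r + n * m).+2%:R / 2 :> rat.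
  have := mul_bin_diag n.+1 1; rewrite bin1 /= => hb.
  have hb' : n.+1%:R * n%:R = 2 * ('C(n.+1, 2))%:R :> rat by rewrite -natrM hb natrM.
  rewrite natrD !natrM -(mulKf (_ : 2 != 0 :> rat) 'C(n.+1, 2)%:R) // -hb'.
  by rewrite -!natr1 natrD !natrM -!natr1; field.
have hm : (dfact m)%:R != 0 :> rat := dfact_neq0 m.
have hE : \prod_(j < n) e (n + j.+1)%N != 0 by apply/prodf_neq0 => j _; apply: dfact_neq0.
have hb : b n != 0 := dfact_neq0 _.
have hk : (2 * r + n * m).+2%:R != 0 :> rat by rewrite pnatr_eq0.
have hn : n.+1%:R != 0 :> rat by rewrite pnatr_eq0.
have hf : (n`!)%:R != 0 :> rat by rewrite pnatr_eq0 -lt0n fact_gt0.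
have hmn : (dfact m)%:R ^+ n != 0 :> rat by rewrite expf_neq0.
rewrite he factS natrM expnS natrM exprS.
move: (\prod_(j < n) e _) (b n) hE hb => X1 X2 hX1 hX2.
move: (\prod_(j < n) _) (\prod_(j < n) _) (\prod_(j < n) _) => Y1 Y2 Y3.
move: hm hmn hf hn hk; move: (_.+2%:R) n.+1%:R (n`!)%:R (dfact m)%:R (_ ^+ n) => *.
by field; rewrite ?hX1 ?hX2; do !(apply/andP; split).
Qed.
End SelbergConstant.

(** * Asymptotics of the Selberg sum *)

Section LastPoint.
Variable n : nat.

Definition extend (y : nat) (x : {ffun 'I_n -> nat}) : {ffun 'I_n.+1 -> nat} :=
  [ffun j => oapp x y (insub (val j))].
Definition restrict (x : {ffun 'I_n.+1 -> nat}) : {ffun 'I_n -> nat} :=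
  [ffun k => x (widen_ord (leqnSn n) k)].

Lemma extend_max y x : extend y x ord_max = y.
Proof. by rewrite ffunE insubF //= ltnn. Qed.

Lemma extend_widen y x k : extend y x (widen_ord (leqnSn n) k) = x k.
Proof. by rewrite ffunE /= (valK k). Qed.

Lemma extendK y x : restrict (extend y x) = x.
Proof. by apply/ffunP => k; rewrite ffunE extend_widen. Qed.

Lemma ord_last (j : 'I_n.+1) : j = ord_max \/ exists k, j = widen_ord (leqnSn n) k.
Proof.
case: (ltnP j n) => h; first by right; exists (Ordinal h); apply/val_inj.
by left; apply/val_inj => /=; apply/eqP; rewrite eqn_leq h -ltnS ltn_ord.
Qed.

Lemma restrictK (x : {ffun 'I_n.+1 -> nat}) : extend (x ord_max) (restrict x) = x.
Proof.
by apply/ffunP => j; case: (ord_last j) => [->|[k ->]]; rewrite ?extend_max ?extend_widen ?ffunE.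
Qed.

Lemma ordx_extend y x : ordx (extend y x) = ordx x && [forall k, (x k < y)%N].
Proof.
apply/ordxP/andP => [h|[/ordxP h1 /forallP h2] i j].
  split; first apply/ordxP => i j ij.
    by have := h (widen_ord (leqnSn n) i) (widen_ord (leqnSn n) j) ij; rewrite !extend_widen.
  apply/forallP => k.
  by have := h (widen_ord (leqnSn n) k) ord_max (ltn_ord k); rewrite extend_widen extend_max.
case: (ord_last i) => [->|[k ->]]; case: (ord_last j) => [->|[l ->]];
  rewrite ?extend_max ?extend_widen //=; first by rewrite ltnn.
- by move=> h; have := ltn_ord l; rewrite ltnNge ltnW.
- exact: h1.
Qed.

Lemma vdm_extend y x : vdm (extend y x) = \prod_k (y%:R - (x k)%:R) * vdm x.
Proof.
rewrite /vdm !big_pairs /= big_ord_recr /= mulrC; congr (_ * _).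
  rewrite (big_ord_narrow (leqnSn n)); apply: eq_bigr => k _.
  by rewrite extend_max extend_widen.
apply: eq_bigr => l _; rewrite [LHS]big_mkcond [RHS]big_mkcond big_ord_recr /=.
rewrite ltnNge (ltnW (ltn_ord l)) mulr1; apply: eq_bigr => k _ /=.
by rewrite !extend_widen.
Qed.

(** The points below the largest one, y, form an increasing point of the box of side y, and the
    factors (y - x_k)^m play the part of u_k^s with q = y and s = m. *)
Lemma tsum_rec m r q :
  tsum n.+1 m r 0 q = \sum_(y < q) y%:R ^+ r * tsum n m r m y.
Proof.
rewrite /tsum -big_filter.
pose s1 := [seq (y, x) | y <- iota 0 q, x <- [seq x <- box 'I_n y | ordx x]].
rewrite (@big_seq_bij _ _ s1 _ (fun p => extend p.1 p.2) (fun x => (x ord_max, restrict x))).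
- rewrite /s1 big_allpairs_dep /= -(subn0 q) -/(index_iota 0 q) big_mkord subn0.
  apply: eq_bigr => y _; rewrite big_filter mulr_sumr; apply: eq_bigr => x _.
  rewrite /weight vdm_extend big_ord_recr /= [X in _ * X * _]big1 ?mulr1 => [|j _]; last by [].
  rewrite extend_max exprMn.
  under eq_bigr => k _ do rewrite extend_widen.
  by rewrite -prodrXl; ring.
- apply: allpairs_uniq_dep; rewrite ?iota_uniq //.
    by move=> y _; rewrite filter_uniq ?uniq_box.
  by move=> [y x] [y' x'] _ _ /= [-> ->].
- by rewrite filter_uniq ?uniq_box.
- move=> [y x] /allpairsPdep [y' [x' [hy hx [-> ->]]]] /=.
  rewrite extend_max extendK; split => //.
  move: hx hy; rewrite !mem_filter ordx_extend mem_box mem_iota add0n => /andP[-> hx] /= hy.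
  rewrite hx mem_box; apply/forallP => j; have /forallP hx' := hx.
  by case: (ord_last j) => [->|[k ->]]; rewrite ?extend_max ?extend_widen // (ltn_trans (hx' k)).
- move=> x; rewrite mem_filter => /andP[ox]; rewrite mem_box => /forallP xq.
  rewrite restrictK; split => //; apply/allpairsPdep; exists (x ord_max), (restrict x); split => //.
    by rewrite mem_iota xq.
  by move: ox; rewrite -{1}(restrictK x) ordx_extend mem_filter mem_box.
Qed.
End LastPoint.

Lemma tsum0 m r s q : tsum 0 m r s q = 1.
Proof.
rewrite /tsum -big_filter.
have -> : [seq x <- box 'I_0 q | ordx x] = [:: [ffun=> 0%N]].
  have h x : x = [ffun=> 0%N] :> {ffun 'I_0 -> nat} by apply/ffunP => -[].
  apply: perm_small_eq => //; apply: uniq_perm => //; first by rewrite filter_uniq ?uniq_box.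
  move=> x; rewrite (h x) inE eqxx mem_filter mem_box; apply/andP; split.
    by apply/ordxP => -[].
  by apply/forallP => -[].
rewrite big_seq1 /weight !big_ord0 /vdm (_ : pairs 0 = [::]) ?big_nil ?expr1n ?mulr1 //.
by apply: size0nil; rewrite size_pairs.
Qed.

Section Asymptotics.
Variable m : nat.
Hypothesis m_gt0 : (0 < m)%N.

Lemma aden_neq0 n r s k : (k < n)%N -> aden n m r s k != 0.
Proof.
move=> kn; apply: lt0r_neq0; rewrite /aden mulr_gt0 // ltr_pwDl //.
  by rewrite mulr_gt0 // ltr0n; lia.
have -> : n%:R - k%:R - 1 = (n - k.+1)%N%:R :> rat by rewrite natrB // -natr1; ring.
by rewrite mulr_ge0 // addr_ge0 // mulr_ge0.
Qed.

(** Runs the recursion in k from 0 to n + 1. Each step multiplies the leading coefficient by [anum]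
    / [aden] and raises the degree by one. *)
Lemma tsum_step n r s S :
  bigO (n + wdeg n.+1 m r s)
    (fun q => tsum n.+1 m r s q - S * q%:R ^+ (n + wdeg n.+1 m r s).+1) ->
  bigO (n + wdeg n.+1 m r s.+1)
    (fun q => tsum n.+1 m r s.+1 q - S * (\prod_(k < n.+1) (anum n.+1 m s k / aden n.+1 m r s k)) *
         q%:R ^+ (n + wdeg n.+1 m r s.+1).+1).
Proof.
set w := wdeg n.+1 m r s => h0.
have step k : (k <= n.+1)%N -> bigO (n + w + k) (fun q => esum n.+1 m r s k q -
    S * (\prod_(i < k) (anum n.+1 m s i / aden n.+1 m r s i)) * q%:R ^+ (n + w + k).+1).
  elim: k => [|k IH] kn.
    by rewrite addn0; apply: eq_bigO h0 => q; rewrite esum0 big_ord0 mulr1.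
  have d0 := aden_neq0 r s kn.
  have h1 := bigOM (bigO_X 1) (IH (ltnW kn)).
  have h2 := aomoto_rec n.+1 r s m_gt0 k.
  have e1 : (n.+1 + (k + w) = n + w + k.+1)%N by lia.
  have e2 : (1 + (n + w + k) = n + w + k.+1)%N by lia.
  rewrite e1 in h2; rewrite e2 in h1.
  have h3 := bigOZ (aden n.+1 m r s k)^-1 (bigOB (bigOZ (anum n.+1 m s k) h1) h2).
  apply: eq_bigO h3 => q; rewrite expr1 big_ord_recr /= addnS [q%:R ^+ (n + w + k).+2]exprS.
  set X := \prod_(i < k) _; set Y := q%:R ^+ _.
  move: (aden _ _ _ _ _) (anum _ _ _ _) d0 => ad an d0; by field.
have hh := step n.+1 (leqnn _).
have e : (n + wdeg n.+1 m r s.+1 = n + w + n.+1)%N by rewrite /w /wdeg; lia.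
by rewrite e; apply: eq_bigO hh => q; rewrite esumn.
Qed.

(** Induction on the number of points and, inside it, on s. The count starts at one point because
    the error exponent is one below the degree, which is 0 for no points. *)
Lemma tsum_asym n r s :
  bigO (n + wdeg n.+1 m r s)
    (fun q => tsum n.+1 m r s q - selberg m n.+1 r s * q%:R ^+ (n + wdeg n.+1 m r s).+1).
Proof.
elim: n r s => [|n IHn] r s.
  elim: s => [|s IHs]; last by rewrite selbergS; apply: tsum_step.
  have e : (0 + wdeg 1 m r 0 = r)%N by rewrite /wdeg bin_small //; lia.
  rewrite e; apply: eq_bigO (asym_powersum r) => q.
  rewrite tsum_rec selberg0; congr (_ - _ * _).
    by apply: eq_bigr => y _; rewrite tsum0 mulr1.
  rewrite /selberg big_ord0 mulr1 expn0 fact0 divr1 mul1r bin_small //; congr (_%:R^-1); lia.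
elim: s => [|s IHs]; last by rewrite selbergS; apply: tsum_step.
set w := wdeg n.+1 m r m.
have e : (n.+1 + wdeg n.+2 m r 0 = r + (n + w).+1)%N.
  by rewrite /w /wdeg binS bin1; lia.
(* [h1] sums the error of the induction hypothesis at s = m, [h2] sums its leading term. *)
have h1 := bigO_psum (bigOM (bigO_X r) (IHn r m)).
have h2 := bigOZ (selberg m n.+1 r m) (asym_powersum (r + (n + w).+1)).
rewrite e; rewrite -/w -addnS in h1.
apply: eq_bigO (bigOD h1 h2) => q; rewrite tsum_rec selberg0.
have -> : (n.+2 * r.+1 + 'C(n.+2, 2) * m = (r + (n + w).+1).+1)%N.
  by rewrite -e /wdeg; lia.
rewrite mulrBr mulr_sumr addrA.
rewrite -big_split /= mulrA; congr (_ - _); apply: eq_bigr => y _.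
by rewrite exprD; ring.
Qed.
End Asymptotics.

(** * Gelfand-Tsetlin patterns *)

Section SeqProduct.
Variable A : eqType.
Implicit Types (S : nat -> seq A) (l : seq A).

Fixpoint seqprod k S : seq (seq A) :=
  if k is k'.+1 then [seq a :: l | a <- S 0%N, l <- seqprod k' (S \o succn)] else [:: [::]].

Lemma size_seqprod k S : size (seqprod k S) = (\prod_(i < k) size (S i))%N.
Proof.
elim: k S => [|k IH] S; first by rewrite big_ord0.
by rewrite big_ord_recl /= size_allpairs IH.
Qed.

Lemma uniq_seqprod k S : (forall i, (i < k)%N -> uniq (S i)) -> uniq (seqprod k S).
Proof.
elim: k S => // k IH S h /=; apply: allpairs_uniq; first exact: h.
  by apply: IH => i ik; apply: h.
by move=> [a l] [b l'] _ _ /= [-> ->].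
Qed.

Lemma mem_seqprod a0 k S l :
  l \in seqprod k S <-> size l = k /\ (forall i, (i < k)%N -> nth a0 l i \in S i).
Proof.
elim: k S l => [|k IH] S l /=.
  by rewrite inE; split=> [/eqP -> //|[/size0nil -> _]].
split=> [/allpairsP[[a l'] [/= aS /IH[sl hl] ->]]|[sl hl]].
  by split=> [|[|i] ik] //=; [rewrite sl|apply: hl].
case: l sl hl => // a l [sl] hl; apply/allpairsP; exists (a, l); split => //=.
  exact: (hl 0%N).
by apply/IH; split => // i ik; apply: (hl i.+1).
Qed.

Lemma big_seqprod a0 k S (F : 'I_k -> A -> rat) :
  \sum_(l <- seqprod k S) \prod_(j < k) F j (nth a0 l j) = \prod_(j < k) \sum_(v <- S j) F j v.
Proof.
elim: k S F => [|k IH] S F /=; first by rewrite big_seq1 !big_ord0.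
rewrite big_allpairs_dep big_ord_recl mulr_suml; apply: eq_bigr => a _.
rewrite -(IH (S \o succn) (fun j => F (lift ord0 j))) mulr_sumr; apply: eq_bigr => l _.
by rewrite big_ord_recl.
Qed.
End SeqProduct.

Section Patterns.

(** The half-open intervals t_a <= y_a < t_{a+1} combine weakly increasing rows with strictly
    increasing columns; this makes the count a product of differences of [t] without shifts. *)
Definition inter k (t : seq nat) : seq (seq nat) :=
  seqprod k (fun a => iota (nth 0%N t a) (nth 0%N t a.+1 - nth 0%N t a)).

Fixpoint patterns k (t : seq nat) : seq (seq (seq nat)) :=
  if k is k'.+1 then flatten [seq [seq t :: p | p <- patterns k' y] | y <- inter k' t]
  else [:: [::]].

Lemma mem_inter k t y : y \in inter k t <->
  size y = k /\ (forall a, (a < k)%N -> (nth 0 t a <= nth 0 y a < nth 0 t a.+1)%N).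
Proof.
rewrite /inter (mem_seqprod 0%N).
have e a : (nth 0%N y a \in iota (nth 0%N t a) (nth 0%N t a.+1 - nth 0%N t a)) =
    (nth 0 t a <= nth 0 y a < nth 0 t a.+1)%N by rewrite mem_iota; lia.
by split=> -[sy h]; split=> // a /h; rewrite e.
Qed.

Definition entry (p : seq (seq nat)) d a : nat := nth 0%N (nth [::] p d) a.

Lemma mem_patterns k t p : size t = k -> p \in patterns k t <->
  [/\ size p = k, (forall d, (d < k)%N -> size (nth [::] p d) = (k - d)%N),
      ((0 < k)%N -> nth [::] p 0 = t) &
      (forall d a, (d + a.+1 < k)%N -> (entry p d a <= entry p d.+1 a < entry p d a.+1)%N)].
Proof.
elim: k t p => [|k IH] t p st /=.
  rewrite inE; split=> [/eqP -> //|[/size0nil -> //]].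
split=> [/flattenP[s /mapP[y /mem_inter[sy hy] ->] /mapP[p' /(IH _ _ sy)[h1 h2 h3 h4] ->]]|].
  split=> //=; first by rewrite h1.
    by case=> [|d] dk //=; apply: h2.
  case=> [|d] a dk; last by apply: h4.
  rewrite /entry /= h3; last by lia.
  by apply: hy.
case: p => [|t' p] [] // [h1 h2 h3 h4].
have {}h3 : t' = t by apply: h3.
rewrite {t'}h3 in h2 h4 *.
have sy : size (nth [::] p 0) = k by case: (k) h1 h2 => [/size0nil ->//|k' _ h2]; apply: (h2 1%N).
apply/flattenP; exists [seq t :: p | p <- patterns k (nth [::] p 0)].
  apply/mapP; exists (nth [::] p 0) => //; apply/mem_inter; split=> // a ak.
  by apply: (h4 0%N).
apply/mapP; exists p => //; apply/(IH _ _ sy); split=> //.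
  by move=> d dk; apply: (h2 d.+1).
by move=> d a dk; apply: (h4 d.+1).
Qed.

Lemma uniq_patterns k t : size t = k -> uniq (patterns k t).
Proof.
elim: k t => // k IH t st.
apply: (@allpairs_uniq_dep _ (fun=> seq (seq nat)) _ (fun=> cons t) (inter k t) (patterns k)).
- by apply: uniq_seqprod => i _; apply: iota_uniq.
- by move=> y /mem_inter[sy _]; apply: IH.
have key y p : y \in inter k t -> p \in patterns k y -> y = nth [::] p 0.
  move=> /mem_inter[sy _] /(mem_patterns _ sy)[sp _ hp _].
  by case: k sy sp hp {IH st} => [/size0nil -> /size0nil -> //|k _ _ ->].
move=> _ _ /allpairsPdep[y1 [p1 [i1 j1 ->]]] /allpairsPdep[y2 [p2 [i2 j2 ->]]] /= [e].
by rewrite (key _ _ i1 j1) (key _ _ i2 j2) e.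
Qed.

(** In the binomial basis, summing an entry over an interlacing interval only raises the column
    index by one. *)
Definition bin_mx k (t : seq nat) : 'M[rat]_k := \matrix_(j, i) ('C(nth 0%N t j, i))%:R.

(** Subtract from every row the preceding one, which is multiplication by the unitriangular [L], and
    expand along the first column. *)
Lemma det_ones_col k (M : 'M[rat]_k.+1) : (forall j, M j 0 = 1) ->
  \det M = \det (\matrix_(j < k, i < k)
     (M (lift ord0 j) (lift ord0 i) - M (widen_ord (leqnSn k) j) (lift ord0 i))).
Proof.
move=> h; pose L : 'M[rat]_k.+1 := \matrix_(j, l) ((j == l)%:R - (val j == l.+1)%:R).
have dL : \det L = 1.
  rewrite det_trig; last first.
    apply/is_trig_mxP => i j ij; rewrite mxE.
    have /negbTE -> : i != j by rewrite neq_ltn ij.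
    have /negbTE -> : val i != j.+1 by rewrite neq_ltn ltnS ltnW.
    by rewrite subrr.
  apply: big1 => i _; rewrite mxE eqxx.
  have /negbTE -> : val i != i.+1 by rewrite neq_ltn ltnSn.
  by rewrite subr0.
rewrite -[LHS]mul1r -dL -det_mulmx.
have LM j i : (L *m M) j i = M j i - \sum_(l < k.+1 | val j == l.+1) M l i.
  rewrite mxE; under eq_bigr => l _ do rewrite mxE mulrBl.
  rewrite sumrB; congr (_ - _).
    rewrite (bigD1 j) //= eqxx mul1r big1 ?addr0 // => l /negbTE; rewrite eq_sym => ->.
    by rewrite mul0r.
  by rewrite [RHS]big_mkcond; apply: eq_bigr => l _; case: eqP; rewrite ?mul1r ?mul0r.
have LM0 i : (L *m M) ord0 i = M ord0 i by rewrite LM big_pred0 ?subr0.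
have LMS j i : (L *m M) (lift ord0 j) i = M (lift ord0 j) i - M (widen_ord (leqnSn k) j) i.
  have e : (fun l : 'I_k.+1 => val (lift ord0 j) == l.+1) =1 pred1 (widen_ord (leqnSn k) j).
    by move=> l /=; rewrite -val_eqE /= eqSS eq_sym.
  by rewrite LM (big_pred1 _ e).
rewrite (expand_det_col _ ord0) big_ord_recl LM0 h mul1r big1 ?addr0; last first.
  by move=> j _; rewrite LMS !h subrr mul0r.
rewrite /cofactor /= expr0 mul1r; congr (\det _); apply/matrixP => j i.
by rewrite !mxE -LMS !mxE.
Qed.

Lemma sum_bin_iota a b i : (a <= b)%N ->
  \sum_(v <- iota a (b - a)) ('C(v, i))%:R = ('C(b, i.+1))%:R - ('C(a, i.+1))%:R :> rat.
Proof.
move=> /subnKC {2}<-; elim: (b - a)%N => [|c IH].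
  by rewrite addn0 big_nil subrr.
by rewrite -addn1 iotaD big_cat IH big_seq1 /= addnA addn1 binS natrD; ring.
Qed.

(** In the expansion over permutations each entry of [y] occurs in one factor, so the sum over [y]
    splits into independent sums over intervals; these give the row differences of
    [det_ones_col]. *)
Lemma bin_mx_rec k t : (forall a, (a < k)%N -> (nth 0 t a <= nth 0 t a.+1)%N) ->
  \sum_(y <- inter k t) \det (bin_mx k y) = \det (bin_mx k.+1 t).
Proof.
move=> st; rewrite det_ones_col; last by move=> j; rewrite mxE bin0.
rewrite exchange_big /=; apply: eq_bigr => s _.
rewrite -mulr_sumr; congr (_ * _).
transitivity (\sum_(y <- inter k t) \prod_(j < k) ('C(nth 0%N y j, s j))%:R : rat).
  by apply: eq_bigr => y _; apply: eq_bigr => j _; rewrite mxE.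
rewrite (big_seqprod 0%N _ (fun (j : 'I_k) v => ('C(v, s j))%:R)).
by apply: eq_bigr => j _; rewrite sum_bin_iota ?st // !mxE.
Qed.

Lemma size_patterns_det k t : size t = k ->
  (forall a, (a.+1 < k)%N -> (nth 0 t a <= nth 0 t a.+1)%N) ->
  (size (patterns k t))%:R = \det (bin_mx k t) :> rat.
Proof.
elim: k t => [|k IH] t st mt; first by rewrite det_mx00.
rewrite -bin_mx_rec; last by move=> a ak; apply: mt.
rewrite /= size_flatten /shape sumnE !big_map natr_sum.
rewrite big_seq [RHS]big_seq; apply: eq_bigr => y /mem_inter[sy hy].
rewrite size_map IH // => a ak.
by have := hy a (ltnW ak); have := hy _ ak; lia.
Qed.

Lemma size_patterns_unsorted k t a : (a < k)%N -> (nth 0 t a.+1 <= nth 0 t a)%N ->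
  patterns k.+1 t = [::].
Proof.
move=> ak h; apply: size0nil; rewrite /= size_flatten /shape sumnE !big_map big_seq big1 // => y.
by move=> /mem_inter[_ /(_ a ak)]; lia.
Qed.

Lemma natr_ffact n k : (n ^_ k)%:R = \prod_(l < k) (n%:R - l%:R) :> rat.
Proof.
elim: k => [|k IH]; first by rewrite big_ord0 ffactn0.
rewrite big_ord_recr /= -IH ffactnSr natrM.
case: (leqP k n) => h; first by rewrite natrB.
by rewrite ffact_small // !mul0r.
Qed.

(** i! C(x, i) is the monic polynomial [P i] of degree i, so a unitriangular change of basis leads
    to the Vandermonde determinant, and the superfactorial collects the i!. *)
Lemma det_bin_mx k t :
  \det (bin_mx k t) * (superfact k)%:R =
  \prod_(j < k) \prod_(i < j) ((nth 0%N t j)%:R - (nth 0%N t i)%:R) :> rat.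
Proof.
pose P i : {poly rat} := \prod_(l < i) ('X - (l%:R)%:P).
have sP i : size (P i) = i.+1.
  by rewrite /P size_prod_XsubC /index_enum -enumT size_enum_ord.
pose a : 'rV[rat]_k := \row_j (nth 0%N t j)%:R.
pose U : 'M[rat]_k := \matrix_(i, l) (P i)`_l.
have dU : \det U = 1.
  rewrite det_trig; last first.
    by apply/is_trig_mxP => i j ij; rewrite mxE nth_default // sP.
  apply: big1 => i _; rewrite mxE -[X in _`_X]/(i.+1.-1) -sP.
  by have /monicP := monic_prod_XsubC (index_enum 'I_i) xpredT (fun l => l%:R : rat).
have e : U *m Vandermonde k a = diag_mx (\row_i ((i : 'I_k)`!)%:R) *m (bin_mx k t)^T.
  apply/matrixP => i j; rewrite mul_diag_mx !mxE.
  transitivity ((P i).[(nth 0%N t j)%:R]).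
    rewrite (@horner_coef_wide _ k) ?sP //; apply: eq_bigr => l _.
    by rewrite !mxE.
  rewrite /P horner_prod -natrM mulnC bin_ffact natr_ffact.
  by apply: eq_bigr => l _; rewrite !hornerE.
have := congr1 determinant e; rewrite !det_mulmx dU mul1r det_diag det_tr mulrC => {}e.
have -> : (superfact k)%:R = \prod_(i < k) (\row_(i < k) (i`!)%:R : 'rV[rat]_k) 0 i.
  by rewrite /superfact natr_prod; apply: eq_bigr => i _; rewrite mxE.
rewrite mulrC in e; rewrite mulrC -e det_Vandermonde (exchange_big_dep xpredT) //=.
apply: eq_bigr => j _; rewrite (big_ord_narrow (ltnW (ltn_ord j))).
by apply: eq_bigr => i _; rewrite !mxE.
Qed.

Lemma superfact_neq0 k : (superfact k)%:R != 0 :> rat.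
Proof.
rewrite /superfact natr_prod; apply/prodf_neq0 => i _.
by rewrite pnatr_eq0 -lt0n fact_gt0.
Qed.

Lemma size_patterns k t : size t = k ->
  (size (patterns k t))%:R =
  (if [forall a : 'I_k, (a.+1 < k)%N ==> (nth 0 t a < nth 0 t a.+1)%N] then
     \prod_(j < k) \prod_(i < j) ((nth 0%N t j)%:R - (nth 0%N t i)%:R) / (superfact k)%:R else 0)
  :> rat.
Proof.
move=> st; case: ifP => [/forallP h|/negbT].
  rewrite -det_bin_mx mulfK ?superfact_neq0 // size_patterns_det // => a ak.
  by move: (h (Ordinal (ltnW ak))) => /implyP/(_ ak) /ltnW.
rewrite negb_forall => /existsP[a]; rewrite negb_imply -leqNgt => /andP[ak h].
case: k st a ak h => [|k] _ a // ak h.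
by rewrite (size_patterns_unsorted (ak : (a < k)%N) h).
Qed.
End Patterns.

(** * Pages as patterns *)

Lemma nth_mkseq2 (A : Type) (a0 : A) (F : nat -> nat -> A) k d a : (d + a < k)%N ->
  nth a0 (nth [::] (mkseq (fun d => mkseq (F d) (k - d)) k) d) a = F d a.
Proof. by move=> h; rewrite nth_mkseq ?nth_mkseq //; lia. Qed.

Section Book.
Variables (n m : nat) (r s : 'I_m -> nat).
Notation incell := (incell n r s).
Notation isdiag := (isdiag n r).
Notation cellof := (cellof n r s).
Notation cell := (YBcell n r s).
Notation bnd := (Bnd n r s).
Implicit Types f : {ffun cell -> nat}.

Lemma k_bnd i : (r i + n + s i < bnd)%N.
Proof.
have h1 : (r i <= \sum_(j < m) r j)%N by rewrite (bigD1 i) //= leq_addr.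
have h2 : (s i <= \sum_(j < m) s j)%N by rewrite (bigD1 i) //= leq_addr.
rewrite /Bnd; lia.
Qed.

Lemma incell_bnd i a b : incell i a b -> (a < bnd)%N /\ (b < bnd)%N.
Proof. by case/and3P; have := k_bnd i; lia. Qed.

Lemma isdiag_incell i a b : isdiag i a b -> incell i a b.
Proof. by case/andP => /eqP -> h; apply/and3P; split; lia. Qed.

Variant cell_spec i a b : option cell -> Type :=
  | CellNone of ~~ incell i a b : cell_spec i a b None
  | CellDiag (j : 'I_n) of a = (b + r i)%N & b = j : cell_spec i a b (Some (inl j))
  | CellOff (z : {x : 'I_m * 'I_bnd * 'I_bnd | offcell x}) of
      (val z).1.1 = i & a = (val z).1.2 & b = (val z).2 & ~~ isdiag i a b & incell i a b :
      cell_spec i a b (Some (inr z)).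

Lemma cellP i a b : cell_spec i a b (cellof i a b).
Proof.
rewrite /Defs.cellof; case: ifP => [/andP[/eqP ha hb]|/negbT hd].
  by rewrite (insubT (fun j => (j < n)%N) hb) /=; constructor.
case: ifP => [hc|/negbT]; last by constructor.
have [ha hb] := incell_bnd hc.
have ho : offcell (i, inord a : 'I_bnd, inord b : 'I_bnd).
  by rewrite /Defs.offcell /= !inordK // hc hd.
by rewrite (insubT (@offcell n m r s) ho) /=; constructor; rewrite //= inordK.
Qed.

Lemma cellof_diag i (j : 'I_n) : cellof i (j + r i) j = Some (inl j).
Proof.
case: cellP => [/negP[]|j' _ e|z _ _ _ /negP[]]; first by apply: isdiag_incell; rewrite /Defs.isdiag eqxx /=.
  by congr (Some (inl _)); apply/val_inj.
by rewrite /Defs.isdiag eqxx /=.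
Qed.

Lemma cellof_off (z : {x : 'I_m * 'I_bnd * 'I_bnd | offcell x}) :
  cellof (val z).1.1 (val z).1.2 (val z).2 = Some (inr z).
Proof.
have /andP[h1 h2] := valP z.
case: cellP => [/negP[] //|j ha hb|z' e1 e2 e3 _ _].
  by case/negP: h2; rewrite /Defs.isdiag ha eqxx hb /=.
move: z z' h1 h2 e1 e2 e3 => [[[i a] b] hz] [[[i' a'] b'] hz'] /= _ _ e1 /val_inj e2 /val_inj e3.
by congr (Some (inr _)); apply/val_inj; rewrite /= e1 e2 e3.
Qed.

Lemma cellof_inj i a b a' b' : incell i a b -> cellof i a b = cellof i a' b' -> a = a' /\ b = b'.
Proof.
move=> h; case: cellP => [/negP[]//|j -> ->|z e1 -> -> _ _];
  case: cellP => [_|j' -> ->|z' e1' -> -> _ _] //.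
  by move=> [->].
by move=> [->].
Qed.

Definition pageval f i a b : nat := if cellof i a b is Some c then f c else 0%N.

(** Only adjacent cells are compared. For strict fillings the Selberg inequalities follow by
    transitivity, see [page_ok_strict]. *)
Definition ssok f := [forall i : 'I_m, forall a : 'I_bnd, forall b : 'I_bnd,
  (incell i a b && incell i a b.+1 ==> (pageval f i a b <= pageval f i a b.+1)%N) &&
  (incell i a b && incell i a.+1 b ==> (pageval f i a b < pageval f i a.+1 b)%N)].

Lemma ssokP f : reflect (forall i a b, incell i a b ->
    (incell i a b.+1 -> (pageval f i a b <= pageval f i a b.+1)%N) /\
    (incell i a.+1 b -> (pageval f i a b < pageval f i a.+1 b)%N)) (ssok f).
Proof.
apply: (iffP idP) => [/forallP h i a b hc|h].
  have [ha hb] := incell_bnd hc.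
  have /forallP/(_ (Ordinal ha))/forallP/(_ (Ordinal hb))/andP[] := h i.
  by rewrite /= hc => /implyP ? /implyP ?.
apply/forallP => i; apply/forallP => a; apply/forallP => b; apply/andP.
by split; apply/implyP => /andP[hc]; have [] := h i _ _ hc.
Qed.

Hypothesis n_gt0 : (0 < n)%N.

Section Fillings.
Variable q : nat.
Implicit Types x : {ffun 'I_n -> nat}.

Definition ksize i := (r i + n + s i)%N.
Definition xn x b : nat := oapp x 0%N (insub b).

Lemma xn_ord x (j : 'I_n) : xn x j = x j.
Proof. by rewrite /xn valK. Qed.

Definition topval x i c : nat :=
  if (c < r i)%N then c else if (c < r i + n)%N then xn x (c - r i) else (q + (c - (r i + n)))%N.
Definition toprow x i : seq nat := mkseq (topval x i) (ksize i).

Lemma size_toprow x i : size (toprow x i) = ksize i.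
Proof. exact: size_mkseq. Qed.

(* Page i completed to a triangle a <= c < r_i + n + s_i, where c = b + r_i; the entries outside
   the page are the ones forced by the top row. *)
Definition trival f i a c : nat :=
  if (c < r i)%N then a else if (r i + n <= a)%N then (q + (a - (r i + n)))%N
  else pageval f i a (c - r i).

Definition page_pattern f i : seq (seq nat) :=
  mkseq (fun d => mkseq (fun a => trival f i a (d + a)) (ksize i - d)) (ksize i).

Lemma entry_page f i d a : (d + a < ksize i)%N -> entry (page_pattern f i) d a = trival f i a (d + a).
Proof. exact: (nth_mkseq2 0%N (fun d a => trival f i a (d + a))). Qed.

Definition diagonal f : {ffun 'I_n -> nat} := [ffun j => f (inl j)].

Lemma mem_boxP (T : finType) (f : {ffun T -> nat}) :
  reflect (forall c, (f c < q)%N) (f \in box T q).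
Proof. by rewrite mem_box; apply: forallP. Qed.

Lemma trival_top f i c : (c < ksize i)%N -> trival f i c c = topval (diagonal f) i c.
Proof.
move=> ck; rewrite /trival /topval; case: ltnP => // rc; case: (leqP (r i + n)) => // cn.
have h : (c - r i < n)%N by lia.
rewrite /pageval -{1}(subnK rc) (cellof_diag i (Ordinal h)).
by rewrite (xn_ord _ (Ordinal h)) ffunE.
Qed.

(** Entries increase strictly down column 0, so row a has entry at least a there. This is the
    inequality across the seam between the left triangle, whose row a is constantly a, and the
    page. *)
Lemma pageval_ge f i a : ssok f -> (a <= r i)%N -> (a < r i + n)%N -> (a <= pageval f i a 0)%N.
Proof.
move=> /ssokP h; elim: a => // a IH ar an.
have hc : incell i a 0 by apply/and3P; split; lia.
have [_] := h i a 0%N hc; have := IH (ltnW ar) (ltnW an) => h1 h2.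
by apply: leq_ltn_trans h1 (h2 _); apply/and3P; split; lia.
Qed.

Lemma trival_row f i a c : ssok f -> (a <= c)%N -> (c.+1 < ksize i)%N ->
  (trival f i a c <= trival f i a c.+1)%N.
Proof.
move=> sf ac ck; rewrite /ksize in ck; rewrite /trival.
case: (ltnP c (r i)) => cr.
  case: (ltnP c.+1 (r i)) => cr' //.
  case: (leqP (r i + n) a) => [|an]; first by lia.
  have -> : (c.+1 - r i = 0)%N by lia.
  by apply: pageval_ge => //; lia.
rewrite ltnNge (leqW cr) /=; case: (leqP (r i + n) a) => // an; rewrite subSn //.
have hc : incell i a (c - r i) by apply/and3P; split; lia.
have /ssokP/(_ i _ _ hc)[h _] := sf; apply: h.
by apply/and3P; split; lia.
Qed.

Lemma trival_col f i a c : ssok f -> f \in box cell q -> (a < c)%N -> (c < ksize i)%N ->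
  (trival f i a c < trival f i a.+1 c)%N.
Proof.
move=> sf /mem_boxP fq ac ck; rewrite /ksize in ck; rewrite /trival.
case: (ltnP c (r i)) => // cr.
case: (leqP (r i + n) a) => an; first by rewrite (leqW an); lia.
case: (leqP (r i + n) a.+1) => an'.
  apply: leq_trans (leq_addr _ _); rewrite /pageval.
  (* Outside the page [pageval] defaults to 0, which is below q since some diagonal cell carries a
     value below q. *)
  by case: (cellof _ _ _) => [z|//]; [apply: fq | apply: leq_ltn_trans (fq (inl (Ordinal n_gt0)))].
have hc : incell i a (c - r i) by apply/and3P; split; lia.
have /ssokP/(_ i _ _ hc)[_ h] := sf; apply: h.
by apply/and3P; split; lia.
Qed.

Lemma page_pattern_mem f i : ssok f -> f \in box cell q ->
  page_pattern f i \in patterns (ksize i) (toprow (diagonal f) i).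
Proof.
move=> sf fq; apply/mem_patterns; rewrite ?size_toprow //; split.
- by rewrite size_mkseq.
- by move=> d dk; rewrite nth_mkseq // size_mkseq.
- move=> k0; rewrite nth_mkseq // subn0; apply/eq_in_map => c; rewrite mem_iota => /andP[_].
  by rewrite !add0n => ck; rewrite trival_top.
- move=> d a da; rewrite !entry_page; try lia.
  have e : (d.+1 + a = d + a.+1)%N by lia.
  by rewrite addSn trival_row ?addnS ?trival_col //=; lia.
Qed.

(* Row d of a pattern holds the cells of the triangle with c - a = d. *)
Definition pent (p : seq (seq nat)) a c : nat := entry p (c - a) a.

Section OnePattern.
Variables (x : {ffun 'I_n -> nat}) (i : 'I_m) (p : seq (seq nat)).
Hypothesis hp : p \in patterns (ksize i) (toprow x i).

Lemma pent_top c : (c < ksize i)%N -> pent p c c = topval x i c.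
Proof.
move=> ck; have [_ _ h _] := (mem_patterns p (size_toprow x i)).1 hp.
by rewrite /pent subnn /entry h ?nth_mkseq //; apply: leq_ltn_trans ck.
Qed.

Lemma pent_step a c : (a <= c)%N -> (c.+1 < ksize i)%N ->
  (pent p a c <= pent p a c.+1 < pent p a.+1 c.+1)%N.
Proof.
move=> ac ck; have [_ _ _ h] := (mem_patterns p (size_toprow x i)).1 hp.
rewrite /pent subSn // subSS; apply: h; lia.
Qed.

Lemma pent_row a c : (a <= c)%N -> (c < ksize i)%N -> (pent p a a <= pent p a c)%N.
Proof.
move=> /subnK <-; elim: (c - a)%N => // d IH ck; apply: leq_trans (IH (ltnW ck)) _.
by have /andP[] := pent_step (leq_addl d a) ck.
Qed.

Lemma pent_col a b c : (a <= b)%N -> (b <= c)%N -> (c < ksize i)%N ->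
  (pent p a c + (b - a) <= pent p b c)%N.
Proof.
move=> /subnK <-; elim: (b - a)%N => [|d IH] bc ck; first by rewrite addnK addn0.
have h := IH (ltnW bc) ck; case: c bc ck h {IH} => // c bc ck h.
have /andP[_ h2] := pent_step (bc : (d + a <= c)%N) ck.
by rewrite addSn; lia.
Qed.

(** The entry is squeezed: its row starts at a on the top row, and its column must climb c - a
    strict steps to reach c there. *)
Lemma pent_left a c : (a <= c)%N -> (c < r i)%N -> pent p a c = a.
Proof.
move=> ac cr; have ck : (c < ksize i)%N by rewrite /ksize; lia.
have := pent_row ac ck; have := pent_col ac (leqnn c) ck.
rewrite !pent_top //; last by apply: leq_ltn_trans ck.
by rewrite /topval cr (leq_ltn_trans ac cr); lia.
Qed.

Lemma pent_bottom a c : (a <= c)%N -> (r i + n <= a)%N -> (c < ksize i)%N ->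
  pent p a c = (q + (a - (r i + n)))%N.
Proof.
move=> ac an ck.
have := pent_row ac ck; have := pent_col ac (leqnn c) ck.
rewrite !pent_top //; last by apply: leq_ltn_trans ck.
by rewrite /topval !ifF; lia.
Qed.

(** Moving down its column, the entry is bounded by x_(c - r_i) < q on the diagonal or, to the right
    of the diagonal cells, lies strictly below the first forced row, which starts at q. *)
Lemma pent_lt a c : x \in box 'I_n q -> (a <= c)%N -> (a < r i + n)%N -> (r i <= c)%N -> (c < ksize i)%N ->
  (pent p a c < q)%N.
Proof.
move=> xq ac an rc ck; case: (ltnP c (r i + n)) => cn.
  have := pent_col ac (leqnn c) ck; rewrite pent_top // /topval ifF 1?ifT //; last by lia.
  have h : (c - r i < n)%N by lia.
  rewrite (xn_ord x (Ordinal h)); have /mem_boxP/(_ (Ordinal h)) := xq => h1 h2.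
  by apply: leq_ltn_trans h1; apply: leq_trans h2; apply: leq_addr.
by have := pent_col (ltnW an) cn ck; rewrite (pent_bottom cn (leqnn _) ck); lia.
Qed.
End OnePattern.
Definition pages x (j : nat) : seq (seq (seq nat)) :=
  if insub j is Some i then patterns (ksize i) (toprow x i) else [::].

Lemma pages_ord x (i : 'I_m) : pages x i = patterns (ksize i) (toprow x i).
Proof. by rewrite /pages valK. Qed.

Definition page_family f : seq (seq (seq nat)) := [seq page_pattern f i | i <- enum 'I_m].

Lemma nth_page_family f (i : 'I_m) : nth [::] (page_family f) i = page_pattern f i.
Proof. by rewrite (nth_map i) ?nth_ord_enum // size_enum_ord. Qed.

Definition glue (x : {ffun 'I_n -> nat}) (ps : seq (seq (seq nat))) : {ffun cell -> nat} :=
  [ffun c : cell => match c with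
   | inl j => x j
   | inr z => let v : 'I_m * 'I_bnd * 'I_bnd := val z in
              pent (nth [::] ps v.1.1) v.1.2 (v.2 + r v.1.1)
   end].

Lemma glue_pageval x (ps : seq (seq (seq nat))) (i : 'I_m) a b : nth [::] ps i \in patterns (ksize i) (toprow x i) ->
  incell i a b -> pageval (glue x ps) i a b = pent (nth [::] ps i) a (b + r i).
Proof.
move=> hp hc; rewrite /pageval; case: cellP => [/negP[]//|j -> e|z <- -> -> _ _].
  case/and3P: hc => _ hb hab; have jn := ltn_ord j.
  rewrite ffunE (pent_top hp); last by rewrite /ksize; lia.
  by rewrite /topval ifF ?ifT ?addnK ?e ?xn_ord //; lia.
by rewrite ffunE.
Qed.

Section Glue.
Variables (x : {ffun 'I_n -> nat}) (ps : seq (seq (seq nat))).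
Hypothesis xq : x \in box 'I_n q.
Hypothesis hps : ps \in seqprod m (pages x).

Lemma glue_page (i : 'I_m) : nth [::] ps i \in patterns (ksize i) (toprow x i).
Proof. by have [_ /(_ i (ltn_ord i))] := (mem_seqprod [::] _ _ _).1 hps; rewrite pages_ord. Qed.

Lemma glue_box : glue x ps \in box cell q.
Proof.
apply/mem_boxP => -[j|z]; rewrite ffunE; first by have /mem_boxP := xq; apply.
have /andP[/and3P[h1 h2 h3] _] := valP z.
by apply: (pent_lt (glue_page _) xq); rewrite /ksize; lia.
Qed.

Lemma glue_ssok : ssok (glue x ps).
Proof.
apply/ssokP => i a b hc; have hg := glue_page i.
have /and3P[h1 h2 h3] := hc.
split=> hc'; have /and3P[h1' h2' h3'] := hc'; rewrite !glue_pageval //.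
  by have /andP[] := @pent_step x i _ hg a (b + r i) h3 ltac:(rewrite /ksize; lia).
have := @pent_col x i _ hg a a.+1 (b + r i) (leqnSn a) h3' ltac:(rewrite /ksize; lia).
by rewrite subSnn addn1.
Qed.

Lemma glue_diagonal : diagonal (glue x ps) = x.
Proof. by apply/ffunP => j; rewrite !ffunE. Qed.

Lemma glue_trival i d a : (d + a < ksize i)%N ->
  trival (glue x ps) i a (d + a) = pent (nth [::] ps i) a (d + a).
Proof.
move=> dk; have hg := glue_page i; rewrite /trival.
case: ltnP => cr; first by rewrite (pent_left hg) // leq_addl.
case: leqP => an; first by rewrite (pent_bottom hg) // leq_addl.
rewrite glue_pageval ?subnK //; apply/and3P; rewrite /ksize in dk; split; lia.
Qed.

Lemma glue_family : page_family (glue x ps) = ps.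
Proof.
have [sp _] := (mem_seqprod [::] _ _ _).1 hps.
apply: (@eq_from_nth _ [::]); first by rewrite size_map size_enum_ord sp.
move=> j; rewrite size_map size_enum_ord => jm.
rewrite (nth_page_family _ (Ordinal jm)); set i := Ordinal jm.
have [h1 h2 _ _] := (mem_patterns _ (size_toprow x i)).1 (glue_page i).
apply: (@eq_from_nth _ [::]); first by rewrite size_mkseq h1.
move=> d; rewrite size_mkseq => dk.
apply: (@eq_from_nth _ 0%N); first by rewrite nth_mkseq // size_mkseq h2.
move=> a; rewrite nth_mkseq // size_mkseq => ak.
by rewrite nth_mkseq // glue_trival; [rewrite /pent addnK|lia].
Qed.
End Glue.

Lemma family_glue f : f \in box cell q -> glue (diagonal f) (page_family f) = f.
Proof.
move=> fq; apply/ffunP => -[j|z]; rewrite !ffunE //; cbv zeta; rewrite nth_page_family.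
have /andP[hc hd] := valP z; have /and3P[h1 h2 h3] := hc.
rewrite /pent entry_page subnK //; last by rewrite /ksize; lia.
rewrite /trival ifF; last by lia.
rewrite ifF; last by lia.
by rewrite addnK /pageval cellof_off.
Qed.

Lemma semistandard_count :
  (count ssok (box cell q))%:R =
  \sum_(x <- box 'I_n q) \prod_(i < m) (size (patterns (ksize i) (toprow x i)))%:R :> rat.
Proof.
transitivity (\sum_(f <- [seq f <- box cell q | ssok f]) (1 : rat)).
  by rewrite big_const_seq iter_addr_0 count_predT size_filter.
transitivity (\sum_(xp <- [seq (x, ps) | x <- box 'I_n q, ps <- seqprod m (pages x)]) (1 : rat)).
  apply: (@big_seq_bij _ _ _ _ (fun xp => glue xp.1 xp.2)
     (fun f => (diagonal f, page_family f)) (fun=> 1)).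
  - apply: allpairs_uniq_dep; rewrite ?uniq_box //.
      move=> x _; apply: uniq_seqprod => j jm.
      rewrite /pages (insubT (fun j => (j < m)%N) jm); apply: uniq_patterns.
      exact: size_toprow.
    by move=> [y p] [y' p'] _ _ /= [-> ->].
  - by rewrite filter_uniq ?uniq_box.
  - move=> _ /allpairsPdep[x [ps [xq hps ->]]] /=.
    by rewrite mem_filter glue_box // glue_ssok // glue_diagonal glue_family.
  - move=> f; rewrite mem_filter => /andP[sf fq]; rewrite /= family_glue //; split=> //.
    apply/allpairsPdep; exists (diagonal f), (page_family f); split=> //.
      by apply/mem_boxP => j; rewrite ffunE; have /mem_boxP := fq; apply.
    apply/(mem_seqprod [::]); split=> [|j jm]; first by rewrite size_map size_enum_ord.
    rewrite (nth_page_family _ (Ordinal jm)) (pages_ord _ (Ordinal jm)).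
    exact: page_pattern_mem.
rewrite big_allpairs_dep; apply: eq_bigr => x _.
rewrite big_const_seq iter_addr_0 count_predT size_seqprod natr_prod.
by apply: eq_bigr => i _; rewrite pages_ord.
Qed.
End Fillings.
End Book.

(** * Leading term of the number of semistandard fillings *)

Section UniformEquivalence.
Variable n : nat.
Implicit Types f g : nat -> {ffun 'I_n -> nat} -> rat.

(** Equality of leading terms of degree d, uniformly over the box. The factor [q.+1] on the left
    avoids the exponent d - 1. *)
Definition equiv d f g := exists2 K : rat, 0 <= K & forall q x, x \in box 'I_n q ->
  [/\ `|f q x| <= K * q.+1%:R ^+ d, `|g q x| <= K * q.+1%:R ^+ d &
      q.+1%:R * `|f q x - g q x| <= K * q.+1%:R ^+ d].

Lemma equiv_cst c : equiv 0 (fun _ _ => c) (fun _ _ => c).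
Proof.
by exists `|c| => // q x _; rewrite expr0 mulr1 subrr normr0 mulr0; split.
Qed.

Lemma equivM d d' f g f' g' : equiv d f g -> equiv d' f' g' ->
  equiv (d + d') (fun q x => f q x * f' q x) (fun q x => g q x * g' q x).
Proof.
move=> [K K0 h] [K' K0' h']; exists (2 * (K * K')) => [|q x xq]; first by rewrite !mulr_ge0.
have [h1 h2 h3] := h q x xq; have [h1' h2' h3'] := h' q x xq.
set B : rat := q.+1%:R in h1 h2 h3 h1' h2' h3' *.
have B0 : 0 <= B by rewrite ler0n.
have e : K * K' * B ^+ (d + d') = (K * B ^+ d) * (K' * B ^+ d') by rewrite exprD; ring.
have Z0 : 0 <= K * K' * B ^+ (d + d') by rewrite !mulr_ge0 ?exprn_ge0.
have e2 : 2 * (K * K') * B ^+ (d + d') = K * K' * B ^+ (d + d') + K * K' * B ^+ (d + d') by ring.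
split.
- by rewrite normrM e2 {1}e (le_trans (ler_pM _ _ h1 h1')) // lerDl.
- by rewrite normrM e2 {1}e (le_trans (ler_pM _ _ h2 h2')) // lerDl.
have -> : f q x * f' q x - g q x * g' q x =
  f q x * (f' q x - g' q x) + (f q x - g q x) * g' q x by ring.
apply: (@le_trans _ _ (`|f q x| * (B * `|f' q x - g' q x|) + (B * `|f q x - g q x|) * `|g' q x|)).
  have -> : `|f q x| * (B * `|f' q x - g' q x|) + (B * `|f q x - g q x|) * `|g' q x| =
    B * (`|f q x| * `|f' q x - g' q x| + `|f q x - g q x| * `|g' q x|) by ring.
  by rewrite ler_wpM2l // -!normrM ler_normD.
by rewrite e2 e lerD // ler_pM // mulr_ge0.
Qed.

Lemma equiv_prod (I : Type) (l : seq I) (d : I -> nat) (f g : I -> nat -> {ffun 'I_n -> nat} -> rat) :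
  (forall i, equiv (d i) (f i) (g i)) ->
  equiv (\sum_(i <- l) d i) (fun q x => \prod_(i <- l) f i q x) (fun q x => \prod_(i <- l) g i q x).
Proof.
move=> h; elim: l => [|i l IH].
  have [K K0 hK] := equiv_cst 1.
  by rewrite big_nil; exists K => // q x xq; have := hK q x xq; rewrite !big_nil.
have [K K0 hK] := equivM (h i) IH.
by rewrite big_cons; exists K => // q x xq; have := hK q x xq; rewrite !big_cons.
Qed.

Lemma equiv_lin (K : rat) f g : 0 <= K ->
  (forall q x, x \in box 'I_n q ->
     [/\ `|f q x| <= K * q.+1%:R, `|g q x| <= K * q.+1%:R & `|f q x - g q x| <= K]) -> equiv 1 f g.
Proof.
move=> K0 h; exists K => // q x xq; have [h1 h2 h3] := h q x xq; rewrite expr1; split=> //.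
by rewrite mulrC ler_wpM2r // ler0n.
Qed.

Lemma equiv_sum d f g : equiv d f g -> (0 < n + d)%N ->
  bigO (n + d).-1 (fun q => \sum_(x <- box 'I_n q | ordx x) (f q x - g q x)).
Proof.
move=> [K K0 h] nd; exists K => q; set B : rat := q.+1%:R.
have B0 : 0 < B by rewrite ltr0n.
rewrite -(ler_pM2l B0) mulrCA -exprS prednK //.
apply: (@le_trans _ _ (\sum_(x <- box 'I_n q) K * B ^+ d)).
  apply: (le_trans (ler_wpM2l (ltW B0) (ler_norm_sum _ _ _))).
  rewrite mulr_sumr big_mkcond big_seq [X in _ <= X]big_seq; apply: ler_sum => x xq.
  by have [_ _ h3] := h q x xq; case: ifP => // _; rewrite mulr_ge0 // exprn_ge0 // ltW.
rewrite big_const_seq count_predT size_box card_ord iter_addr_0 -[_ *+ (_ ^ _)]mulr_natr natrX.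
rewrite exprD -mulrA ler_wpM2l // mulrC ler_wpM2r ?exprn_ge0 ?ler0n //.
by apply: lerXn2r; rewrite ?nnegrE ?ler0n // ler_nat.
Qed.
End UniformEquivalence.

Lemma prod_ord_add a b (F : nat -> rat) :
  \prod_(j < a + b) F j = (\prod_(j < a) F j) * \prod_(j < b) F (a + j)%N.
Proof. by rewrite big_split_ord. Qed.

Lemma superfactE k : (superfact k)%:R = \prod_(j < k) \prod_(l < j) (j%:R - l%:R) :> rat.
Proof.
rewrite /superfact natr_prod; apply: eq_bigr => j _.
by rewrite -natr_ffact ffactnn.
Qed.

Section PageProduct.
Variables (n m : nat) (r s : 'I_m -> nat).
Hypothesis n_gt0 : (0 < n)%N.
Implicit Types x : {ffun 'I_n -> nat}.

(** The Vandermonde product of the top row split into blocks: the differences inside the left and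
    the right block give superfactorials, and the other four kinds are listed. *)
Definition page_prod i q x : rat :=
  (superfact (r i) * superfact (s i))%N%:R / (superfact (n + r i + s i))%:R *
  ((\prod_(j < n) \prod_(l < r i) ((x j)%:R - l%:R)) * vdm x *
   (\prod_(j < s i) \prod_(l < r i) (q%:R + j%:R - l%:R)) *
   (\prod_(j < s i) \prod_(l < n) (q%:R + j%:R - (x l)%:R))).

Lemma topval_left q x i c : (c < r i)%N -> topval r q x i c = c.
Proof. by rewrite /topval => ->. Qed.

Lemma topval_mid q x i (j : 'I_n) : topval r q x i (r i + j) = x j.
Proof.
rewrite /topval ifF ?ifT ?addKn ?xn_ord //; first by rewrite ltn_add2l.
by rewrite ltnNge leq_addr.
Qed.

Lemma topval_right q x i c : topval r q x i (r i + n + c) = (q + c)%N.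
Proof. by rewrite /topval !ifF ?addKn //; lia. Qed.

Lemma vdm_nat x : vdm x = \prod_(j < n) \prod_(l < j) ((x j)%:R - (xn x l)%:R).
Proof.
rewrite /vdm big_pairs; apply: eq_bigr => j _ /=.
rewrite (big_ord_narrow (ltnW (ltn_ord j))); apply: eq_bigr => l _.
by rewrite -(xn_ord x (widen_ord _ l)).
Qed.

Lemma toprow_prod i q x :
  \prod_(j < ksize n r s i) \prod_(l < j)
     ((nth 0%N (toprow r s q x i) j)%:R - (nth 0%N (toprow r s q x i) l)%:R)
  / (superfact (ksize n r s i))%:R = page_prod i q x.
Proof.
pose T c : rat := (topval r q x i c)%:R.
have -> : superfact (ksize n r s i) = superfact (n + r i + s i) by rewrite /ksize [(n + _)%N]addnC.
rewrite /page_prod natrM.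
transitivity ((\prod_(j < ksize n r s i) \prod_(l < j) (T j - T l)) /
   (superfact (n + r i + s i))%:R).
  congr (_ / _); apply: eq_bigr => j _; apply: eq_bigr => l _.
  by rewrite !nth_mkseq // (ltn_trans (ltn_ord l)).
have TL c : (c < r i)%N -> T c = c%:R by move=> h; rewrite /T topval_left.
have TM (j : 'I_n) : T (r i + j)%N = (x j)%:R by rewrite /T topval_mid.
have TR c : T (r i + n + c)%N = q%:R + c%:R by rewrite /T topval_right natrD.
rewrite /ksize (prod_ord_add (r i + n) (s i) (fun j => \prod_(l < j) (T j - T l))).
rewrite (prod_ord_add (r i) n (fun j => \prod_(l < j) (T j - T l))).
have -> : \prod_(j < r i) \prod_(l < j) (T j - T l) = (superfact (r i))%:R.
  rewrite superfactE; apply: eq_bigr => j _; apply: eq_bigr => l _.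
  by rewrite !TL // (ltn_trans (ltn_ord l)).
have -> : \prod_(j < n) \prod_(l < r i + j) (T (r i + j)%N - T l) =
   (\prod_(j < n) \prod_(l < r i) ((x j)%:R - l%:R)) * vdm x.
  rewrite vdm_nat -big_split; apply: eq_bigr => j _ /=.
  rewrite (prod_ord_add (r i) j (fun l => T (r i + j)%N - T l)) TM; congr (_ * _).
    by apply: eq_bigr => l _; rewrite TL.
  apply: eq_bigr => l _; have ln : (l < n)%N by apply: ltn_trans (ltn_ord j).
  by rewrite (TM (Ordinal ln)) -(xn_ord x (Ordinal ln)).
have -> : \prod_(j < s i) \prod_(l < r i + n + j) (T (r i + n + j)%N - T l) =
   (\prod_(j < s i) \prod_(l < r i) (q%:R + j%:R - l%:R)) *
   (\prod_(j < s i) \prod_(l < n) (q%:R + j%:R - (x l)%:R)) * (superfact (s i))%:R.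
  rewrite superfactE -!big_split; apply: eq_bigr => j _ /=.
  rewrite (prod_ord_add (r i + n) j (fun l => T (r i + n + j)%N - T l)).
  rewrite (prod_ord_add (r i) n (fun l => T (r i + n + j)%N - T l)) TR; congr (_ * _ * _).
  - by apply: eq_bigr => l _; rewrite TL.
  - by apply: eq_bigr => l _; rewrite TM.
  - by apply: eq_bigr => l _; rewrite TR; ring.
by ring.
Qed.
End PageProduct.

Section LeadingTerm.
Variables (n m : nat) (r s : 'I_m -> nat).
Hypothesis n_gt0 : (0 < n)%N.
Implicit Types x : {ffun 'I_n -> nat}.

Lemma consecutive_ordx x :
  (forall a, (a.+1 < n)%N -> (xn x a < xn x a.+1)%N) -> ordx x.
Proof.
move=> h; have g a d : (a + d.+1 < n)%N -> (xn x a < xn x (a + d.+1))%N.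
  elim: d => [|d IH] had; first by rewrite addn1 in had *; apply: h.
  by rewrite addnS in had *; apply: ltn_trans (h _ had); apply: IH; apply: ltnW.
apply/ordxP => i j ij; rewrite -!(xn_ord x).
have e : (i + (j - i.+1).+1 = j)%N by lia.
by rewrite -e; apply: g; rewrite e.
Qed.

(** The right side does not test whether the whole top row increases. For increasing [x] this can
    fail only if some x_j < r_i, and then the factor x_j - l with l = x_j kills [page_prod]. *)
Lemma size_page q x i : x \in box 'I_n q ->
  (size (patterns (ksize n r s i) (toprow r s q x i)))%:R = (ordx x)%:R * page_prod r s i q x :> rat.
Proof.
move=> /mem_boxP xq.
rewrite size_patterns ?size_toprow // toprow_prod //.
set k := ksize n r s i.
have nthT a : (a < k)%N -> nth 0%N (toprow r s q x i) a = topval r q x i a by apply: nth_mkseq.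
case: ifP => [/forallP h|/negbT].
  suff -> : ordx x by rewrite mul1r.
  apply: consecutive_ordx => a an.
  have ak : ((r i + a).+1 < k)%N by rewrite /k /ksize; lia.
  move: (h (Ordinal (ltnW ak))) => /implyP/(_ ak) /=.
  rewrite !nthT ?(ltnW ak) // -addnS.
  by rewrite (topval_mid r q x i (Ordinal (ltnW an))) (topval_mid r q x i (Ordinal an)) -!xn_ord.
rewrite negb_forall => /existsP[a]; rewrite negb_imply -leqNgt => /andP[ak].
rewrite !nthT //.
case: (boolP (ordx x)) => [/ordxP ox|]; last by rewrite mul0r.
rewrite mul1r /page_prod => hle.
(* The only possible descent is at the seam from r_i - 1 to x_0: the other seam is excluded by x_j <
   q, and each block increases. *)
have [j0 hx] : exists j0 : 'I_n, (x j0 < r i)%N.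
  move: hle; rewrite /topval; case: (ltnP a.+1 (r i)) => ar; first by rewrite (ltnW ar) ltnn.
  case: (ltnP a (r i)) => ar'.
    rewrite ifT; last by lia.
    have -> : (a.+1 - r i = 0)%N by lia.
    by rewrite (xn_ord x (Ordinal n_gt0)) => h; exists (Ordinal n_gt0); apply: leq_ltn_trans ar'.
  case: (ltnP a.+1 (r i + n)) => an.
    rewrite (ltnW an) subSn //.
    have h1 : (a - r i < n)%N by lia. have h2 : ((a - r i).+1 < n)%N by lia.
    rewrite (xn_ord x (Ordinal h1)) (xn_ord x (Ordinal h2)) leqNgt.
    by rewrite ox.
  case: (ltnP a (r i + n)) => an'; last by lia.
  have h1 : (a - r i < n)%N by lia.
  by rewrite (xn_ord x (Ordinal h1)) => h; have := leq_trans (xq (Ordinal h1)) (leq_trans (leq_addr _ _) h); rewrite ltnn.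
have -> : \prod_(j < n) \prod_(l < r i) ((x j)%:R - l%:R) = 0 :> rat.
  by rewrite (bigD1 j0) //= (bigD1 (Ordinal hx)) //= subrr !mul0r.
by rewrite !mul0r mulr0.
Qed.

Definition page_cst i : rat :=
  (superfact (r i) * superfact (s i))%N%:R / (superfact (n + r i + s i))%:R.

Definition page_lead i (q : nat) x : rat :=
  page_cst i *
  ((\prod_(j < n) \prod_(l < r i) (x j)%:R) * vdm x * (\prod_(j < s i) \prod_(l < r i) q%:R) *
   (\prod_(j < s i) \prod_(l < n) (q%:R - (x l)%:R))).

Lemma box_bounds q x (j : 'I_n) : x \in box 'I_n q ->
  [/\ 0 <= (x j)%:R :> rat, (x j)%:R <= q%:R :> rat & 0 <= q%:R :> rat].
Proof. by move=> /mem_boxP h; rewrite !ler0n ler_nat ltnW. Qed.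

Lemma page_equiv i :
  equiv (n * r i + 'C(n, 2) + s i * r i + s i * n) (page_prod r s i) (page_lead i).
Proof.
have cM k (l : nat) : (\sum_(j < k) \sum_(t < l) 1 = k * l)%N.
  by rewrite sum_nat_const card_ord sum_nat_const card_ord muln1.
have qS (q : nat) : q.+1%:R = q%:R + 1 :> rat by rewrite -natr1.
have e : (n * r i + 'C(n, 2) + s i * r i + s i * n =
   0 + (\sum_(j < n) \sum_(l < r i) 1 + \sum_(p <- pairs n) 1 +
     \sum_(j < s i) \sum_(l < r i) 1 + \sum_(j < s i) \sum_(l < n) 1))%N.
  by rewrite !cM sum1_size size_pairs.
rewrite e; apply: equivM; first exact: equiv_cst.
apply: equivM; first (apply: equivM; first apply: equivM).
- apply: equiv_prod => j; apply: equiv_prod => l.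
  apply: (equiv_lin (K := l%:R + 1)); first by rewrite addr_ge0.
  move=> q x xq; have [h1 h2 h3] := box_bounds j xq; have l0 : 0 <= l%:R :> rat by rewrite ler0n.
  split; rewrite ?qS ler_norml; apply/andP; split; nra.
- apply: equiv_prod => p; apply: (equiv_lin (K := 1)) => //.
  move=> q x xq; have [h1 h2 h3] := box_bounds p.1 xq; have [h4 h5 h6] := box_bounds p.2 xq.
  by split; rewrite ?qS ?subrr ler_norml; apply/andP; split; lra.
- apply: equiv_prod => j; apply: equiv_prod => l.
  apply: (equiv_lin (K := j%:R + l%:R + 1)); first by rewrite !addr_ge0.
  move=> q x xq; have [_ _ h3] := box_bounds (Ordinal n_gt0) xq.
  have l0 : 0 <= l%:R :> rat by rewrite ler0n.
  have j0 : 0 <= j%:R :> rat by rewrite ler0n.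
  split; rewrite ?qS ler_norml; apply/andP; split; nra.
- apply: equiv_prod => j; apply: equiv_prod => l.
  apply: (equiv_lin (K := j%:R + 1)); first by rewrite !addr_ge0.
  move=> q x xq; have [h1 h2 h3] := box_bounds l xq.
  have j0 : 0 <= j%:R :> rat by rewrite ler0n.
  split; rewrite ?qS ler_norml; apply/andP; split; nra.
Qed.

Notation rr := (\sum_(i < m) r i)%N.
Notation ss := (\sum_(i < m) s i)%N.
Notation rs := (\sum_(i < m) r i * s i)%N.

Lemma prod_page_lead q x : \prod_(i < m) page_lead i q x =
  \prod_(i < m) page_cst i * (q%:R ^+ rs * weight m rr ss q x).
Proof.
have h (t : 'I_m -> nat) (u : 'I_n -> rat) : \prod_(i < m) \prod_(j < n) u j ^+ t i =
    \prod_(j < n) u j ^+ (\sum_(i < m) t i).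
  by rewrite exchange_big; apply: eq_bigr => j _; rewrite prodrXr.
rewrite /weight -(h r (fun j => (x j)%:R)) -(h s (fun j => q%:R - (x j)%:R)) -prodrXr.
have -> : vdm x ^+ m = \prod_(i < m) vdm x by rewrite prodr_const card_ord.
rewrite -!big_split; apply: eq_bigr => i _ /=; rewrite /page_lead; congr (_ * _).
have -> : \prod_(j < n) \prod_(l < r i) (x j)%:R = \prod_(j < n) (x j)%:R ^+ r i :> rat.
  by apply: eq_bigr => j _; rewrite prodr_const card_ord.
have -> : \prod_(j < s i) \prod_(l < n) (q%:R - (x l)%:R) = \prod_(j < n) (q%:R - (x j)%:R) ^+ s i :> rat.
  by rewrite exchange_big; apply: eq_bigr => j _; rewrite prodr_const card_ord.
have -> : \prod_(j < s i) \prod_(l < r i) q%:R = q%:R ^+ (r i * s i) :> rat.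
  by rewrite prodr_const card_ord prodr_const card_ord exprM.
by ring.
Qed.

Lemma semistandard_asym : (0 < m)%N ->
  bigO (YBsize n r s).-1 (fun q => (count (@ssok n m r s) (box (YBcell n r s) q))%:R -
    (\prod_(i < m) page_cst i) * selberg m n rr ss * q%:R ^+ YBsize n r s).
Proof.
move=> m0.
have eN : YBsize n r s = (n + (wdeg n m rr ss + rs))%N by rewrite /YBsize /wdeg; lia.
pose d i := (n * r i + 'C(n, 2) + s i * r i + s i * n)%N.
have ed : (\sum_(i < m) d i = wdeg n m rr ss + rs)%N.
  rewrite /d !big_split /= sum_nat_const card_ord -big_distrr -big_distrl /wdeg /=.
  by under [X in (_ + X + _)%N = _]eq_bigr => i _ do rewrite mulnC; lia.
have h1 := equiv_sum (equiv_prod (index_enum 'I_m) page_equiv).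
rewrite ed -eN in h1; have {}h1 := h1 ltac:(rewrite /YBsize; lia).
have h2 := bigOM (bigO_X rs) (@tsum_asym m m0 n.-1 rr ss).
rewrite prednK // in h2.
have h3 := bigOZ (\prod_(i < m) page_cst i) h2.
have e2 : (rs + (n.-1 + wdeg n m rr ss) = (YBsize n r s).-1)%N by rewrite eN; lia.
rewrite e2 in h3; apply: eq_bigO (bigOD h1 h3) => q.
have -> : (n.-1 + wdeg n m rr ss).+1 = (n + wdeg n m rr ss)%N by lia.
rewrite sumrB semistandard_count //.
have -> : \sum_(x <- box 'I_n q) \prod_(i < m) (size (patterns (ksize n r s i) (toprow r s q x i)))%:R =
   \sum_(x <- box 'I_n q | ordx x) \prod_(i < m) page_prod r s i q x.
  rewrite [RHS]big_mkcond big_seq [RHS]big_seq; apply: eq_bigr => x xq.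
  under eq_bigr => i _ do rewrite size_page //.
  case: (ordx x); first by apply: eq_bigr => i _; rewrite mul1r.
  by rewrite (bigD1 (Ordinal m0)) //= !mul0r.
under [X in _ - X + _]eq_bigr => x _ do rewrite prod_page_lead.
rewrite -!mulr_sumr -/(tsum n m rr ss q).
have -> : q%:R ^+ YBsize n r s = q%:R ^+ rs * q%:R ^+ (n + wdeg n m rr ss) :> rat.
  by rewrite -exprD eN; congr (_ ^+ _); lia.
by ring.
Qed.
End LeadingTerm.

(** * Young books and semistandard fillings *)

Section Standardization.
Variables (n m : nat) (r s : 'I_m -> nat).
Notation incell := (incell n r s).
Notation isdiag := (isdiag n r).
Notation cellof := (cellof n r s).
Notation cell := (YBcell n r s).
Notation bnd := (Bnd n r s).
Notation size_N := (YBsize n r s).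

Lemma sum_interval B lo hi : (hi <= B)%N -> (\sum_(b < B) (lo <= b < hi)%N = hi - lo)%N.
Proof.
suff -> : (\sum_(b < B) (lo <= b < hi)%N = minn B hi - lo)%N by move=> /minn_idPr ->.
elim: B => [|B IH]; first by rewrite big_ord0 min0n sub0n.
rewrite big_ord_recr /= IH; case: (leqP lo B); case: (ltnP B hi) => /=; lia.
Qed.

(** Truncated subtraction covers both kinds of rows: a row a < r_i starts at column 0, the others
    start just after their diagonal cell. *)
Lemma offcellE i (a b : 'I_bnd) :
  offcell (i, a, b) = ((a < r i + n) && (a.+1 - r i <= b < n + s i))%N.
Proof.
rewrite /offcell /Defs.incell /Defs.isdiag /=.
by apply/idP/idP; case: eqP; lia.
Qed.

Lemma page_card i :
  (\sum_(a < bnd) \sum_(b < bnd) offcell (i, a, b) = n * r i + n * s i + r i * s i + 'C(n, 2))%N.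
Proof.
have hk := @k_bnd n m r s i.
transitivity (\sum_(a < bnd | a < r i + n) (n + s i - (a.+1 - r i)))%N.
  rewrite [RHS]big_mkcond; apply: eq_bigr => a _.
  under eq_bigr => b _ do rewrite offcellE.
  case: ltnP => _ /=; last by rewrite big1.
  by apply: sum_interval; lia.
have hb : (r i + n <= bnd)%N by lia.
rewrite (big_ord_narrow hb) /= big_split_ord /=.
have -> : (\sum_(j < r i) (n + s i - (j.+1 - r i)) = r i * (n + s i))%N.
  rewrite -[X in (X * _)%N]card_ord -sum_nat_const; apply: eq_bigr => j _.
  by have := ltn_ord j; lia.
have -> : (\sum_(j < n) (n + s i - ((r i + j).+1 - r i)) = 'C(n, 2) + n * s i)%N.
  rewrite (reindex_inj rev_ord_inj) /= -bin2_sum big_mkord.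
  rewrite -[X in (_ + X * _)%N]card_ord -sum_nat_const -big_split; apply: eq_bigr => j _ /=.
  by have := ltn_ord j; lia.
lia.
Qed.

Lemma card_cell : #|{: cell}| = size_N.
Proof.
rewrite card_sum card_ord card_sig -sum1_card big_mkcond /=.
have -> : (\sum_(x : 'I_m * 'I_bnd * 'I_bnd) (if offcell x then 1 else 0) =
    \sum_(i < m) \sum_(a < bnd) \sum_(b < bnd) offcell (i, a, b))%N.
  rewrite pair_big pair_big; apply: eq_bigr => -[[i a] b] _ /=.
  by case: offcell.
under eq_bigr => i _ do rewrite page_card.
rewrite !big_split /= sum_nat_const card_ord -!big_distrr /= /YBsize.
by move: (\sum_(i < m) r i * s i)%N (\sum_(i < m) r i)%N (\sum_(i < m) s i)%N => x y z; lia.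
Qed.

Definition strict (f : {ffun cell -> nat}) := forall i a b, incell i a b ->
    (incell i a b.+1 -> (pageval f i a b < pageval f i a b.+1)%N) /\
    (incell i a.+1 b -> (pageval f i a b < pageval f i a.+1 b)%N).

Lemma strict_ssok (f : {ffun cell -> nat}) : injective f -> ssok f <-> strict f.
Proof.
move=> fi; split=> [/ssokP h i a b hc|h]; last first.
  by apply/ssokP => i a b hc; have [h1 h2] := h i a b hc; split=> // /h1 /ltnW.
have [h1 h2] := h i a b hc; split=> // hc'; rewrite ltn_neqAle h1 // andbT.
have := @cellof_inj n m r s i a b a b.+1 hc; rewrite /pageval.
case: cellP => [/negP[]//|j _ _|z _ _ _ _ _]; case: cellP => [/negP[]//|j' _ _|z' _ _ _ _ _] h3;
  apply/eqP => /fi h4; by have := h3 (congr1 Some h4); lia.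
Qed.

Lemma strict_mono (f g : {ffun cell -> nat}) :
  (forall c d, (f c < f d)%N = (g c < g d)%N) -> strict f -> strict g.
Proof.
move=> fg h i a b hc; have [h1 h2] := h i a b hc; split=> hc'.
  have := h1 hc'; rewrite /pageval.
  by case: cellP => [/negP[]//|j _ _|z _ _ _ _ _]; case: cellP => [/negP[]//|j' _ _|z' _ _ _ _ _];
    rewrite fg.
have := h2 hc'; rewrite /pageval.
by case: cellP => [/negP[]//|j _ _|z _ _ _ _ _]; case: cellP => [/negP[]//|j' _ _|z' _ _ _ _ _];
  rewrite fg.
Qed.

Lemma strict_row f i a b b' : strict f -> incell i a b -> incell i a b' -> (b < b')%N ->
  (pageval f i a b < pageval f i a b')%N.
Proof.
move=> h hc hc' bb'; rewrite -(subnKC bb') in hc' *.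
elim: (b' - b.+1)%N hc' => [|d IH] hc'; first by rewrite addn0 in hc' *; case: (h i a b hc) => ->.
have hc2 : incell i a (b.+1 + d) by move: hc hc' => /and3P[? ? ?] /and3P[? ? ?]; apply/and3P; split; lia.
by rewrite addnS in hc' *; apply: ltn_trans (IH hc2) _; case: (h i a _ hc2) => ->.
Qed.

Lemma strict_col f i a a' b : strict f -> incell i a b -> incell i a' b -> (a < a')%N ->
  (pageval f i a b < pageval f i a' b)%N.
Proof.
move=> h hc hc' bb'; rewrite -(subnKC bb') in hc' *.
elim: (a' - a.+1)%N hc' => [|d IH] hc'; first by rewrite addn0 in hc' *; case: (h i a b hc) => _ ->.
have hc2 : incell i (a.+1 + d) b by move: hc hc' => /and3P[? ? ?] /and3P[? ? ?]; apply/and3P; split; lia.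
by rewrite addnS in hc' *; apply: ltn_trans (IH hc2) _; case: (h i _ b hc2) => _ ->.
Qed.

Lemma cellofT i a b : incell i a b -> exists c, cellof i a b = Some c.
Proof. by move=> h; case: cellP => [/negP[]//|j _ _|z _ _ _ _ _]; eexists. Qed.

Lemma cellofF i a b : ~~ incell i a b -> cellof i a b = None.
Proof.
move=> h; case: cellP => // [j ea eb|z _ _ _ _ hc]; case/negP: h => //.
by apply: isdiag_incell; rewrite /Defs.isdiag ea eqxx eb /=.
Qed.

Lemma optlt_pageval (g : filling n r s) c i a b i' a' b' dir : cellof i a b = Some c ->
  incell i' a' b' -> optlt g c (cellof i' a' b') dir =
  if dir then (pageval (nval g) i a b < pageval (nval g) i' a' b')%N
  else (pageval (nval g) i' a' b' < pageval (nval g) i a b)%N.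
Proof. by move=> e /cellofT[c' e']; rewrite /pageval e e' /optlt !ffunE. Qed.

(** The Selberg clauses of [page_ok] compare a cell with the diagonal cell of its row or column, and
    increasing rows and columns already order such a pair. *)
Lemma page_ok_strict (g : filling n r s) :
  (forall (i : 'I_m) (a b : 'I_bnd), page_ok g i a b) <-> strict (nval g).
Proof.
split=> [h i a b hc|h i a b].
  have [ha hb] := incell_bnd hc; have [c ec] := cellofT hc.
  have := h i (Ordinal ha) (Ordinal hb); rewrite /page_ok /= ec => /and3P[h1 h2 _].
  by split=> hc'; move: h1 h2; rewrite (optlt_pageval g true ec hc').
rewrite /page_ok; case: (boolP (incell i a b)) => [hc|/cellofF -> //].
have [c ec] := cellofT hc; rewrite ec.
have ol i' a' b' dir : (incell i' a' b' -> if dir then (pageval (nval g) i a b < pageval (nval g) i' a' b')%N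
  else (pageval (nval g) i' a' b' < pageval (nval g) i a b)%N) -> optlt g c (cellof i' a' b') dir.
  move=> h'; case: (boolP (incell i' a' b')) => [hc'|/cellofF -> //].
  by rewrite (optlt_pageval g dir ec hc'); apply: h'.
have [h1 h2] := h i a b hc.
apply/and3P; split; [exact: ol | exact: ol | case: c ec {ol} (ol) => // z ez ol].
have hd : ~~ isdiag i a b.
  by move: ez; case: cellP.
have /and3P[q1 q2 q3] := hc.
apply/andP; split; case: ifP => // hr; apply: ol => hc'.
  by apply: strict_row => //; move: hd; rewrite /Defs.isdiag; case: eqP; lia.
by apply: strict_col => //; move: hd; rewrite /Defs.isdiag hr; case: eqP; lia.
Qed.
End Standardization.

Section OrderType.
Variables (T : finType) (N q : nat).
Hypothesis cardT : #|T| = N.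

Lemma onto_ord (g : {ffun T -> 'I_N}) : injective g -> forall k, k \in codom g.
Proof. by move=> gi; apply: inj_card_onto => //; rewrite card_ord cardT. Qed.

(** A bijection onto ['I_N] is determined by the order that it induces on [T]; [place_inj] recovers
    [g] in this way. *)
Lemma card_below (g : {ffun T -> 'I_N}) c : injective g -> #|[set d | (g d < g c)%N]| = g c.
Proof.
move=> gi; rewrite -(card_imset _ gi).
have -> : g @: [set d | (g d < g c)%N] = [set k : 'I_N | (k < g c)%N].
  apply/setP => k; rewrite inE; apply/imsetP/idP => [[d]|h]; first by rewrite inE => ? ->.
  have /codomP[d e] := onto_ord gi k; exists d => //; by rewrite inE -e.
rewrite cardsE -sum1_card (eq_bigl (fun k : 'I_N => (k < g c)%N)) //.
by rewrite (big_ord_narrow (ltnW (ltn_ord (g c)))) sum1_card card_ord.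
Qed.

Lemma injective_ltn (f : {ffun T -> nat}) (g : {ffun T -> nat}) :
  (forall c d, (f c < f d)%N = (g c < g d)%N) -> injective f -> injective g.
Proof.
move=> fg fi c d e; apply: fi; apply/eqP; rewrite eqn_leq.
by apply/andP; split; rewrite leqNgt fg e ltnn.
Qed.

(** [g] gives the ranks of the cells and an increasing [t] lists the N values used, so [place]
    inverts standardization. *)
Definition place (t : N.-tuple 'I_q) (g : {ffun T -> 'I_N}) : {ffun T -> 'I_q} :=
  [ffun c => tnth t (g c)].

Lemma tnth_sorted (t : N.-tuple 'I_q) : sorted ltn [seq val k | k <- t] ->
  forall i j : 'I_N, (tnth t i < tnth t j)%N = (i < j)%N.
Proof.
move=> st.
have mono (i j : 'I_N) : (i < j)%N -> (tnth t i < tnth t j)%N.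
  move=> ij; have [x0 _] : exists x0 : 'I_q, True by exists (tnth t i).
  rewrite !(tnth_nth x0) -!(nth_map x0 0%N val) ?size_tuple //.
  by apply: (sorted_ltn_nth ltn_trans 0%N st) => //; rewrite inE size_map size_tuple.
move=> i j; case: (ltngtP i j) => [/mono ->//|/mono h|/val_inj ->]; last by rewrite ltnn.
by rewrite ltnNge ltnW.
Qed.

Lemma place_ltn (t : N.-tuple 'I_q) g : sorted ltn [seq val k | k <- t] ->
  forall c d, (place t g c < place t g d)%N = (g c < g d)%N.
Proof. by move=> st c d; rewrite !ffunE tnth_sorted. Qed.

Lemma place_inj (t t' : N.-tuple 'I_q) (g g' : {ffun T -> 'I_N}) : sorted ltn [seq val k | k <- t] -> sorted ltn [seq val k | k <- t'] ->
  injective g -> injective g' -> place t g = place t' g' -> (t, g) = (t', g').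
Proof.
move=> st st' gi gi' e.
have eg : g = g'.
  apply/ffunP => c; apply/val_inj; rewrite /= -(card_below c gi) -(card_below c gi').
  by apply: eq_card => d; rewrite !inE -(place_ltn g st) -(place_ltn g' st') e.
congr (_, _) => //; apply: eq_from_tnth => k; have /codomP[c ->] := onto_ord gi k.
by have /ffunP/(_ c) := e; rewrite !ffunE -eg.
Qed.

Lemma place_onto (f : {ffun T -> 'I_q}) : injective f ->
  exists (t : N.-tuple 'I_q) (g : {ffun T -> 'I_N}), [/\ sorted ltn [seq val k | k <- tval t], injective g & f = place t g].
Proof.
(* The rank of a cell is the number of cells with a smaller value; it is less than N because the
   cell itself is not counted. *)
move=> fi; pose below c := [set d | (f d < f c)%N].
have bN c : (#|below c| < N)%N.
  rewrite -cardT -cardsT; apply: proper_card; rewrite properE subsetT /=.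
  by apply/subsetPn; exists c; rewrite !inE // ltnn.
pose g : {ffun T -> 'I_N} := [ffun c => Ordinal (bN c)].
have mono c d : (f c < f d)%N -> (g c < g d)%N.
  move=> h; rewrite !ffunE /=; apply: proper_card; rewrite properE; apply/andP; split.
    by apply/subsetP => e; rewrite !inE => /ltn_trans; apply.
  by apply/subsetPn; exists c; rewrite !inE // ltnn.
have gi : injective g.
  move=> c d e; apply: fi; apply/val_inj/eqP; rewrite /= eqn_leq.
  by apply/andP; split; rewrite leqNgt; apply/negP => /mono; rewrite e ltnn.
pose gV k := iinv (onto_ord gi k).
have gVK k : g (gV k) = k by apply: f_iinv.
have refl_mono c d : (g c < g d)%N -> (f c < f d)%N.
  move=> h; rewrite ltnNge leq_eqVlt; apply/norP; split.
    by apply/negP => /eqP/val_inj/fi e; rewrite e ltnn in h.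
  by apply/negP => /mono; rewrite ltnNge ltnW.
exists (mktuple (fun k => f (gV k))), g; split=> //; last first.
  by apply/ffunP => c; rewrite [RHS]ffunE tnth_mktuple; congr (f _); apply: (gi); rewrite gVK.
apply/(sortedP 0%N) => k; rewrite size_map size_tuple => kN.
have k0 := ltnW kN; pose x0 := f (gV (Ordinal kN)).
rewrite !(nth_map x0) ?size_tuple // -[k in nth x0 _ k]/(val (Ordinal k0)).
rewrite -[k.+1]/(val (Ordinal kN)) -!tnth_nth !tnth_mktuple.
by apply: refl_mono; rewrite !gVK.
Qed.
End OrderType.

Section CountInjective.
Variables (n m : nat) (r s : 'I_m -> nat).
Notation cell := (YBcell n r s).
Notation size_N := (YBsize n r s).

Lemma mem_YB (g : filling n r s) : (g \in YB n r s) <-> injective g /\ strict (nval g).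
Proof.
rewrite inE /is_young_book; split.
  case/and3P => /injectiveP gi _ /forallP h; split=> //; apply/page_ok_strict => i a b.
  by have /forallP/(_ a)/forallP/(_ b) := h i.
case=> gi /page_ok_strict h; apply/and3P; split; first exact/injectiveP.
  by apply/forallP; apply: onto_ord => //; apply: card_cell.
by apply/forallP => i; apply/forallP => a; apply/forallP => b.
Qed.

Lemma nval_injective q (f : {ffun cell -> 'I_q}) : injective f <-> injective (nval f).
Proof.
split=> fi c d e; apply: fi; last by rewrite !ffunE e.
by apply/val_inj; move: e; rewrite !ffunE.
Qed.

Lemma card_injective_ssok q :
  #|[set f : {ffun cell -> 'I_q} | injectiveb f && ssok (nval f)]| = ('C(q, size_N) * #|YB n r s|)%N.
Proof.
pose S := [set t : size_N.-tuple 'I_q | sorted ltn [seq val k | k <- t]].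
have cS : #|S| = 'C(q, size_N) by apply: card_ltn_sorted_tuples.
rewrite -cS -cardsX.
rewrite -(@card_in_imset _ _ (fun tg => place tg.1 tg.2) (mem (setX S (YB n r s)))); last first.
  move=> [t g] [t' g']; rewrite !in_setX /= ![_ \in S]inE => /andP[st /mem_YB[gi _]] /andP[st' /mem_YB[gi' _]].
  by apply: place_inj => //; apply: card_cell.
apply: eq_card => f; rewrite inE; apply/andP/imsetP => [[/injectiveP fi sf]|[[t g]]].
  have [t [g [st gi ef]]] := place_onto (card_cell n r s) fi.
  exists (t, g) => //; rewrite in_setX /= [_ \in S]inE st; apply/mem_YB; split=> //.
  have h := (strict_ssok ((nval_injective f).1 fi)).1 sf.
  apply: (strict_mono _ h) => c d; rewrite ![nval _ _]ffunE ef /=.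
  by rewrite (place_ltn g st).
rewrite in_setX [_ \in S]inE /= => /andP[st /mem_YB[gi sg]] ->.
have e c d : (nval g c < nval g d)%N = (nval (place t g) c < nval (place t g) d)%N.
  by rewrite ![nval _ _]ffunE /= (place_ltn g st).
have pi : injective (nval (place t g)) by apply: injective_ltn e _; apply/nval_injective.
split; first by apply/injectiveP/nval_injective.
by apply/strict_ssok => //; apply: strict_mono e sg.
Qed.

Lemma count_ssok q : count (@ssok n m r s) (box cell q) =
  #|[set f : {ffun cell -> 'I_q} | ssok (nval f)]|.
Proof.
by rewrite -sum1_count big_map big_enum_cond /= sum1dep_card.
Qed.

(** The excess over the injective fillings is at most the number of all non-injective maps, q^N
    minus the falling factorial. *)
Lemma count_ssok_bounds q :
  ('C(q, size_N) * #|YB n r s| <= count (@ssok n m r s) (box cell q) <=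
   'C(q, size_N) * #|YB n r s| + (q ^ size_N - q ^_ size_N))%N.
Proof.
rewrite count_ssok -card_injective_ssok.
pose A := [set f : {ffun cell -> 'I_q} | ssok (nval f)].
pose B := [set f : {ffun cell -> 'I_q} | injectiveb f && ssok (nval f)].
rewrite -/A -/B.
have BA : B \subset A by apply/subsetP => f; rewrite !inE => /andP[].
rewrite subset_leq_card //= -(cardsID B A) (setIidPr BA) leq_add2l.
have cI := card_inj_ffuns cell 'I_q; rewrite card_ord card_cell in cI.
have := cardsC [set f : {ffun cell -> 'I_q} | injectiveb f].
rewrite card_ffun card_ord card_cell cI => <-; rewrite addKn; apply: subset_leq_card.
by apply/subsetP => f; rewrite !inE; case: ssok => //=; rewrite ?andbT ?andbF.
Qed.

Lemma ffact_asym k : bigO k (fun q => (q ^_ k.+1)%:R - q%:R ^+ k.+1).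
Proof.
elim: k => [|k IH].
  by apply: (eq_bigO _ (bigO0 0)) => q; rewrite ffactn1 expr1 subrr.
have h1 := bigOM IH (bigO_X 1); rewrite addn1 in h1.
have h2 : bigO k.+1 (fun q => (q ^_ k.+1)%:R * - k.+1%:R).
  have h3 := bigOD (bigO_weak (leqnSn k) IH) (bigO_X k.+1).
  by apply: eq_bigO (bigOZ (- k.+1%:R) h3) => q; ring.
apply: eq_bigO (bigOD h1 h2) => q.
by rewrite [(q ^_ k.+2)%:R]natr_ffact big_ord_recr /= -natr_ffact expr1 [q%:R ^+ k.+2]exprSr; ring.
Qed.

Lemma count_ssok_asym : (0 < size_N)%N ->
  bigO (size_N).-1 (fun q => (count (@ssok n m r s) (box cell q))%:R -
     #|YB n r s|%:R / (size_N`!)%:R * q%:R ^+ size_N).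
Proof.
move=> N0; have hF := ffact_asym (size_N).-1; rewrite prednK // in hF.
have h1 := bigOZ (#|YB n r s|%:R / (size_N`!)%:R) hF.
have f0 : (size_N`!)%:R != 0 :> rat by rewrite pnatr_eq0 -lt0n fact_gt0.
have h2 : bigO (size_N).-1 (fun q => (count (@ssok n m r s) (box cell q))%:R -
     ('C(q, size_N) * #|YB n r s|)%N%:R).
  apply: bigO_le hF => q; have /andP[l1 l2] := count_ssok_bounds q.
  have lf : (q ^_ size_N <= q ^ size_N)%N.
    rewrite ffact_prod -[X in (_ <= _ ^ X)%N]card_ord -prod_nat_const.
    by apply: leq_prod => i _; apply: leq_subr.
  rewrite [X in _ <= X]distrC -natrX -!natrB // !normr_nat ler_nat leq_subLR.
  exact: l2.
apply: eq_bigO (bigOD h2 h1) => q.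
rewrite -bin_ffact !natrM; by field.
Qed.
End CountInjective.

Unset Implicit Arguments.
Set Strict Implicit.
Set Printing Implicit Defensive.

Theorem theorem4p8 (n m : nat) (r s : 'I_m -> nat) :
  (0 < n)%N -> (0 < m)%N ->
  let rr := (\sum_(i < m) r i)%N in
  let ss := (\sum_(i < m) s i)%N in
  (#|YB n r s|%:R : rat) =
    ((YBsize n r s)`!)%:R
    * (\prod_(i < m) ((superfact (r i) * superfact (s i))%N%:R
                      / (superfact (n + r i + s i))%N%:R))
    * ((2 ^ n)%N%:R / (n`!)%:R)
    * (\prod_(j < n) ((dfact (j.+1 * m) * dfact (2 * rr + j * m)
                        * dfact (2 * ss + j * m))%N%:R
                      / (dfact m * dfact (2 * rr + 2 * ss + 2 + (n + j.+1 - 2) * m))%N%:R)).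
Proof.
move=> n0 m0 rr ss.
have N0 : (0 < YBsize n r s)%N by rewrite /YBsize; lia.
have h := bigOB (semistandard_asym r s n0 m0) (count_ssok_asym N0).
set c := \prod_(i < m) page_cst n r s i * selberg m n rr ss in h.
have f0 : ((YBsize n r s)`!)%:R != 0 :> rat by rewrite pnatr_eq0 -lt0n fact_gt0.
(* Both estimates concern the same count with error of order N - 1, so their leading coefficients
   coincide. *)
have /subr0_eq e : #|YB n r s|%:R / ((YBsize n r s)`!)%:R - c = 0.
  apply: (@bigO_const_eq0 (YBsize n r s).-1); rewrite prednK //.
  by apply: eq_bigO h => q; ring.
by rewrite -[LHS](divfK f0) e mulrC /c /selberg !mulrA.
Qed.
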